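(* Let $\beta\in\{1,2,4\}$ and let $b\ne0$ be real. Consider on $U=\{(\sigma_1,\sigma_2)\in\mathbb R^2:4\sigma_2<\sigma_1^2\}$ the system $$g_{11}-\sigma_2g_{22}=\tfrac\beta2g_2+2bg_1,\qquad 2g_{12}+\sigma_1g_{22}=2bg_2,$$ for functions $g$ that extend by continuity to $\sigma_1=\sigma_2=0$, with initial conditions $g(0,0)=0$ and $\frac{\partial g(\sigma_1,0)}{\partial\sigma_1}\big|_{\sigma_1=0}=\frac1{2b}$. The solution is $$g(\sigma_1,\sigma_2)=\frac1{2b^2}\Big((1-C)e^{2b\sigma_1}+(2C-1)e^{b\sigma_1}\mathcal I_{(\beta-1)/2}\big(b\sqrt{\sigma_1^2-4\sigma_2}\big)-C\Big),$$ where $C$ is an arbitrary real constant. Thus $$L(\theta)=\exp\Big(-\frac{\sigma_1}{2b}+\frac1{2b^2}\Big((1-C)e^{2b\sigma_1}+(2C-1)e^{b\sigma_1}\mathcal I_{(\beta-1)/2}\big(b\sqrt{\sigma_1^2-4\sigma_2}\big)-C\Big)\Big).$$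
   Context: $g_i=\partial g/\partial\sigma_i$, $g_{ij}=\partial^2g/\partial\sigma_i\partial\sigma_j$; solutions are (sufficiently smooth) functions on $U$. $\mathcal I_\nu(x)=\Gamma(\nu+1)(2/x)^\nu I_\nu(x)$, where $I_\nu$ is the modified Bessel function of the first kind; it is an even entire function with value $1$ at $0$. In the formula for $L$: $\theta$ is a $2\times2$ real symmetric ($\beta=1$), complex Hermitian ($\beta=2$) or quaternionic Hermitian ($\beta=4$) matrix, $\sigma_1=\mathrm{tr}\,\theta$, $\sigma_2=\det\theta$ (sum and product of the two real eigenvalues), and $L$ is the function obtained from $g$ through the relation $g(\sigma_1(\theta),\sigma_2(\theta))=\ln L(\theta)+\frac1{2b}\mathrm{tr}\,\theta$. *)

(* Defs.v *)
From HB Require Import structures.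
From mathcomp Require Import all_boot all_order all_algebra.
From mathcomp Require Import all_classical all_reals all_analysis.
From mathcomp Require Import complex ring.

Set Implicit Arguments.
Unset Strict Implicit.
Unset Printing Implicit Defensive.

Import Order.TTheory GRing.Theory Num.Theory.
Import numFieldNormedType.Exports.

Local Open Scope classical_set_scope.
Local Open Scope ring_scope.

(** * Quaternions [a + b i + c j + d k] over a nontrivial commutative ring *)

Record quat (R : Type) : Type := Quat { qre : R; qi : R; qj : R; qk : R }.

Section QuatChoice.
Variable R : Type.
Definition quat_tuple (q : quat R) : R * R * R * R :=
  (qre q, qi q, qj q, qk q).
Definition tuple_quat (t : R * R * R * R) : quat R :=
  let: (a, b, c, d) := t in Quat a b c d.
Lemma quat_tupleK : cancel quat_tuple tuple_quat.
Proof. by case. Qed.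
End QuatChoice.

HB.instance Definition _ (R : eqType) :=
  Equality.copy (quat R) (can_type (@quat_tupleK R)).
HB.instance Definition _ (R : choiceType) :=
  Choice.copy (quat R) (can_type (@quat_tupleK R)).

Section QuatRing.
Variable R : comNzRingType.
Implicit Types p q : quat R.

Definition addq p q :=
  Quat (qre p + qre q) (qi p + qi q) (qj p + qj q) (qk p + qk q).
Definition oppq p := Quat (- qre p) (- qi p) (- qj p) (- qk p).
Definition zeroq : quat R := Quat 0 0 0 0.
Definition oneq : quat R := Quat 1 0 0 0.
Definition mulq p q := Quat
  (qre p * qre q - qi p * qi q - qj p * qj q - qk p * qk q)
  (qre p * qi q + qi p * qre q + qj p * qk q - qk p * qj q)
  (qre p * qj q - qi p * qk q + qj p * qre q + qk p * qi q)
  (qre p * qk q + qi p * qj q - qj p * qi q + qk p * qre q).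

Fact addqA : associative addq.
Proof. by case=> ? ? ? ? [? ? ? ?] [? ? ? ?]; congr Quat; rewrite /= addrA. Qed.
Fact addqC : commutative addq.
Proof. by case=> ? ? ? ? [? ? ? ?]; congr Quat; rewrite /= addrC. Qed.
Fact add0q : left_id zeroq addq.
Proof. by case=> ? ? ? ?; congr Quat; rewrite /= add0r. Qed.
Fact addNq : left_inverse zeroq oppq addq.
Proof. by case=> ? ? ? ?; congr Quat; rewrite /= addNr. Qed.

HB.instance Definition _ :=
  GRing.isZmodule.Build (quat R) addqA addqC add0q addNq.

Fact mulqA : associative mulq.
Proof. by case=> ? ? ? ? [? ? ? ?] [? ? ? ?]; congr Quat => /=; ring. Qed.
Fact mul1q : left_id oneq mulq.
Proof. by case=> ? ? ? ?; congr Quat => /=; ring. Qed.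
Fact mulq1 : right_id oneq mulq.
Proof. by case=> ? ? ? ?; congr Quat => /=; ring. Qed.
Fact mulqDl : left_distributive mulq +%R.
Proof. by case=> ? ? ? ? [? ? ? ?] [? ? ? ?]; congr Quat => /=; ring. Qed.
Fact mulqDr : right_distributive mulq +%R.
Proof. by case=> ? ? ? ? [? ? ? ?] [? ? ? ?]; congr Quat => /=; ring. Qed.
Fact oneq_neq0 : oneq != 0.
Proof. by apply/eqP => -[] /eqP; rewrite oner_eq0. Qed.

HB.instance Definition _ := GRing.Zmodule_isNzRing.Build (quat R)
  mulqA mul1q mulq1 mulqDl mulqDr oneq_neq0.

Definition conjq q := Quat (qre q) (- qi q) (- qj q) (- qk q).
Definition realq (a : R) : quat R := Quat a 0 0 0.

End QuatRing.

(** * Self-adjoint 2 x 2 matrices *)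

Definition self_adjoint (E : Type) (conj : E -> E) (A : 'M[E]_2) : Prop :=
  (map_mx conj A)^T = A.

(** Trace and determinant are real for self-adjoint matrices; taking the real
    part only lands them in [R].  Quaternions do not commute, but the diagonal
    entries of a self-adjoint matrix are real and its off-diagonal ones are
    conjugate, so no choice of order is involved in [qdet]; the lemma
    [qeigenvalueP] below identifies the roots of the resulting characteristic
    polynomial with the real eigenvalues. *)
Definition ctr (R : realType) (A : 'M[R[i]]_2) : R := complex.Re (\tr A).
Definition cdet (R : realType) (A : 'M[R[i]]_2) : R := complex.Re (\det A).
Definition qtr (R : realType) (A : 'M[quat R]_2) : R := qre (\tr A).
Definition qdet (R : realType) (A : 'M[quat R]_2) : R :=
  qre (A ord0 ord0 * A ord_max ord_max - A ord0 ord_max * A ord_max ord0).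

Lemma mul_realq_eq0 (R : realType) (a : R) (q : quat R) :
  realq a * q = 0 -> a = 0 \/ q = 0.
Proof.
have [->|a0] := eqVneq a 0; first by left.
case: q => x y z t [e0 e1 e2 e3]; right.
by congr Quat; apply: (mulfI a0); rewrite mulr0;
  [rewrite -[RHS]e0|rewrite -[RHS]e1|rewrite -[RHS]e2|rewrite -[RHS]e3]; ring.
Qed.

Lemma self_adjoint_quat (R : realType) (A : 'M[quat R]_2) :
  self_adjoint (@conjq R) A ->
  exists a d q, [/\ A ord0 ord0 = realq a, A ord_max ord_max = realq d,
    A ord0 ord_max = q & A ord_max ord0 = conjq q].
Proof.
move=> /matrixP h; have h00 := h ord0 ord0; have h11 := h ord_max ord_max.
have h10 := h ord_max ord0; rewrite !mxE in h00 h11 h10.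
have real (p : quat R) : conjq p = p -> p = realq (qre p).
  case: p => x y z t pK; have [e1 e2 e3] : [/\ - y = y, - z = z & - t = t].
    by case: pK.
  by congr Quat; rewrite //=; apply/eqP; rewrite -eqNr; apply/eqP.
exists (qre (A ord0 ord0)), (qre (A ord_max ord_max)), (A ord0 ord_max).
by split; [exact: real|exact: real| |].
Qed.

Lemma qeigenvalueP (R : realType) (A : 'M[quat R]_2) (l : R) :
  self_adjoint (@conjq R) A ->
  (exists2 v : 'cV[quat R]_2, v != 0 & A *m v = realq l *: v) <->
  l ^+ 2 - qtr A * l + qdet A = 0.
Proof.
move=> /self_adjoint_quat[a [d [q [A00 A11 A01 A10]]]].
pose D := (a - l) * (d - l)
  - (qre q ^+ 2 + qi q ^+ 2 + qj q ^+ 2 + qk q ^+ 2).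
have -> : l ^+ 2 - qtr A * l + qdet A = D.
  rewrite /qtr /qdet /mxtrace big_ord_recl big_ord1.
  rewrite (_ : lift _ _ = ord_max) ?A00 ?A11 ?A01 ?A10; last exact/val_inj.
  by rewrite /D; case: q {A01 A10 D} => x y z t /=; ring.
have eigE (v : 'cV[quat R]_2) : A *m v = realq l *: v <->
    realq (a - l) * v ord0 ord0 + q * v ord_max ord0 = 0 /\
    conjq q * v ord0 ord0 + realq (d - l) * v ord_max ord0 = 0.
  have rB (x y : R) : realq (x - y) = realq x - realq y.
    by congr Quat; rewrite /= subrr.
  have m1 : lift ord0 ord0 = ord_max :> 'I_2 by exact/val_inj.
  rewrite !rB !mulrBl; split.
    move=> /matrixP h; have h0 := h ord0 ord0; have h1 := h ord_max ord0.
    rewrite !mxE !big_ord_recl big_ord0 m1 addr0 A00 A01 in h0.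
    rewrite !mxE !big_ord_recl big_ord0 m1 addr0 A10 A11 in h1.
    by rewrite addrAC h0 subrr addrA h1 subrr.
  move=> [h0 h1]; apply/matrixP => i j; rewrite ord1.
  rewrite !mxE !big_ord_recl big_ord0 m1 addr0.
  have [->|->] : i = ord0 \/ i = ord_max.
    by case: i => -[|[|//]] ?; [left|right]; exact/val_inj.
  - by apply/eqP; rewrite A00 A01 -subr_eq0 addrAC h0.
  - by apply/eqP; rewrite A10 A11 -subr_eq0 -addrA h1.
split=> [[v v0 /eigE[h0 h1]]|D0].
- have hx : realq D * v ord0 ord0 = 0.
    transitivity (realq (d - l) * (realq (a - l) * v ord0 ord0
        + q * v ord_max ord0)
      - q * (conjq q * v ord0 ord0 + realq (d - l) * v ord_max ord0)).
      rewrite /D; case: (v ord0 ord0) (v ord_max ord0) => ? ? ? ? [? ? ? ?].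
      by case: (q) => ? ? ? ?; congr Quat => /=; ring.
    by rewrite h0 h1 !mulr0 subr0.
  have hy : realq D * v ord_max ord0 = 0.
    transitivity (realq (a - l) * (conjq q * v ord0 ord0
        + realq (d - l) * v ord_max ord0)
      - conjq q * (realq (a - l) * v ord0 ord0 + q * v ord_max ord0)).
      rewrite /D; case: (v ord0 ord0) (v ord_max ord0) => ? ? ? ? [? ? ? ?].
      by case: (q) => ? ? ? ?; congr Quat => /=; ring.
    by rewrite h0 h1 !mulr0 subr0.
  have [//|x0] := mul_realq_eq0 hx; have [//|y0] := mul_realq_eq0 hy.
  case/eqP: v0; apply/matrixP => i j; rewrite ord1 mxE.
  by case: i => -[|[|//]] ?; [rewrite -x0|rewrite -y0]; congr (v _ _);
    exact/val_inj.
- have [e|ne] := eqVneq (realq (a - l), q) 0.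
    exists (\col_i (if i == ord0 then 1 else 0)).
      by apply/eqP => /matrixP/(_ ord0 ord0)/eqP; rewrite !mxE oner_eq0.
    apply/eigE; rewrite !mxE /= !mulr0 !addr0 !mulr1.
    rewrite (congr1 fst e : realq (a - l) = 0) (congr1 snd e : q = 0).
    by split=> //; congr Quat; rewrite /= oppr0.
  exists (\col_i (if i == ord0 then - q else realq (a - l))).
    apply: contra_neq ne => /matrixP h.
    have := h ord0 ord0; have := h ord_max ord0; rewrite !mxE /= => -> /eqP.
    by rewrite oppr_eq0 => /eqP ->.
  apply/eigE; rewrite !mxE /=; move: D0; rewrite /D.
  case: (q) => x y z t /= D0; split; congr Quat => /=; try ring.
  by rewrite -[RHS]D0; ring.
Qed.

(** * Special functions *)

Section SpecialFunctions.
Variable R : realType.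
Implicit Types nu x : R.

Definition Gamma x : R :=
  \int[@lebesgue_measure R]_(t in `]0, +oo[) (t `^ (x - 1) * expR (- t)).

(** Modified Bessel function of the first kind, for [x > 0]. *)
Definition besselI nu x : R :=
  limn (series (fun k : nat =>
    (x / 2) `^ (k.*2%:R + nu) / (k`!%:R * Gamma (k%:R + nu + 1)))).

(** [Gamma (nu + 1) * (2 / x) ^ nu * I_nu x] for [x > 0], extended to the real
    line as the even function with value [1] at [0]. *)
Definition besselI_norm nu x : R :=
  if x == 0 then 1 else Gamma (nu + 1) * (2 / `|x|) `^ nu * besselI nu `|x|.

End SpecialFunctions.

(** * The system *)

Section System.
Variable R : realType.
Implicit Types (g : R * R -> R) (s : R * R) (b C : R) (beta : nat).

Definition U : set (R * R) := [set s | 4 * s.2 < s.1 ^+ 2].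

Definition D1 g : R * R -> R := 'D_((1, 0) : R * R) g.
Definition D2 g : R * R -> R := 'D_((0, 1) : R * R) g.

Definition C1_on (D : set (R * R)) g : Prop := forall s, D s ->
  [/\ derivable g s (1, 0), derivable g s (0, 1),
      {for s, continuous (D1 g)} & {for s, continuous (D2 g)}].
Definition C2_on (D : set (R * R)) g : Prop :=
  [/\ C1_on D g, C1_on D (D1 g) & C1_on D (D2 g)].

(** Only the values of [g] on [U] are meaningful. [extU g] is the extension by
    continuity of [g] to the points of the closure of [U] where it exists. *)
Definition extU g s : R := lim (g @ within U (nbhs s)).

Definition solution beta b g : Prop :=
  [/\ C2_on U g,
      forall s, U s ->
        D1 (D1 g) s - s.2 * D2 (D2 g) s
          = beta%:R / 2 * D2 g s + 2 * b * D1 g s /\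
        2 * D2 (D1 g) s + s.1 * D2 (D2 g) s = 2 * b * D2 g s,
      cvg (g @ within U (nbhs ((0, 0) : R * R))),
      extU g (0, 0) = 0 &
      is_derive (0 : R) 1 (fun x : R => extU g (x, 0)) (2 * b)^-1].

Definition gsol beta b C s : R :=
  (2 * b ^+ 2)^-1 *
  ((1 - C) * expR (2 * b * s.1)
   + (2 * C - 1) * expR (b * s.1)
     * besselI_norm ((beta%:R - 1) / 2) (b * Num.sqrt (s.1 ^+ 2 - 4 * s.2))
   - C).

(** [g (tr A, det A) = ln (L A) + tr A / (2 b)]; the point [(tr A, det A)] lies
    in [U] unless [A] is scalar, when it lies on the boundary of [U]. *)
Definition L_of (T : Type) (herm : T -> Prop) (tr det : T -> R) b g
    (L : T -> R) : Prop :=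
  forall A, herm A ->
    0 < L A /\ extU g (tr A, det A) = ln (L A) + (2 * b)^-1 * tr A.

Definition L_formula (T : Type) (herm : T -> Prop) (tr det : T -> R)
    beta b C (L : T -> R) : Prop :=
  forall A, herm A ->
    L A = expR (- (tr A / (2 * b)) + gsol beta b C (tr A, det A)).

End System.

(* Main.v *)
(** In the variables [t = s1], [u = s1^2 - 4 s2] the second equation says that
    [exp (- b t) * g] has a [t]-derivative depending on [t] only, so that
    [g = exp (b t) * (F t + G u)].  The first equation then separates into
    [F'' = b^2 F + K] and [4 u G'' + (2 + 2 beta) G' = b^2 G - K].  After
    absorbing [K], [F] is a combination of [exp (b t)] and [exp (- b t)], and [G]
    solves a Bessel equation whose second solution is unbounded at [u = 0], which
    continuity at the origin excludes.  The two initial conditions leave one of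
    the three remaining constants free. *)

Require Import Defs.
From mathcomp Require Import all_boot all_order all_algebra.
From mathcomp Require Import all_classical all_reals all_analysis.
From mathcomp Require Import complex measurable_realfun ring lra.

Set Implicit Arguments.
Unset Strict Implicit.
Unset Printing Implicit Defensive.

Import Order.TTheory GRing.Theory Num.Theory.
Import numFieldNormedType.Exports.

Local Open Scope classical_set_scope.
Local Open Scope ring_scope.

(** The square root in [gsol] hides that the solutions extend smoothly across the boundary of [U].
    Calculations therefore use the entire series [psi a 0] at the polynomial [bessel_arg], with
    [a = (beta%:R + 1) / 2], and the three-constant family [ksol] on the whole plane. The integral
    [Gamma] and the series [besselI] enter only through [besselI_normE], which rests on the
    recurrence of [Gamma]. For uniqueness, [F] and [G] must be differentiated twice although [g] is
    known only through its partial derivatives. Both can be written through values of [g] on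
    straight lines inside [U], where partial derivatives suffice. The unbounded Bessel solution is
    never constructed: boundedness makes a Wronskian vanish instead. *)

(** * Euler's integral for Gamma: convergence, positivity, recurrence *)

Section GammaFunction.
Variable R : realType.
Implicit Types a t x : R.
Notation mu := (@lebesgue_measure R).

(** Apply [ln z < z] at [z = t / (2 * (a + 1))]: then [a * ln t] is at most a constant plus [t / 2].
    Half of the exponential decay survives, which serves both for domination by an exponential
    density and for the limit at infinity. *)
Lemma powR_le_expR a : 0 <= a ->
  exists K : R, forall t, 0 < t -> t `^ a * expR (- t) <= K * expR (- (t / 2)).
Proof.
move=> a0; exists (expR (a * ln (2 * (a + 1)))) => t t0.
rewrite /powR gt_eqF// -!expRD ler_expR.
have a1 : 0 < 2 * (a + 1) by lra.
have := @ln_sublinear _ (t / (2 * (a + 1))) (divr_gt0 t0 a1).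
rewrite ln_div ?posrE// => /ltW h.
have : a * ln t <= a * (ln (2 * (a + 1)) + t / (2 * (a + 1))).
  by rewrite ler_wpM2l//; lra.
have : a * (t / (2 * (a + 1))) <= t / 2.
  rewrite mulrA ler_pdivrMr// mulrC.
  have -> : t / 2 * (2 * (a + 1)) = t * (a + 1) by field.
  by rewrite ler_wpM2l ?ltW//; lra.
by rewrite mulrDr; lra.
Qed.

Lemma measurable_gamma_integrand a :
  measurable_fun [set: R] (fun t => t `^ a * expR (- t)).
Proof.
apply: measurable_funM; first exact: measurable_powR.
by apply: measurableT_comp => //; exact: measurable_oppr.
Qed.

Lemma integrable_gamma a : 0 <= a ->
  mu.-integrable `]0, +oo[ (EFin \o (fun t => t `^ a * expR (- t))).
Proof.
move=> a0; have [K hK] := @powR_le_expR a a0.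
have h2 : 0 < 2^-1 :> R by rewrite invr_gt0.
apply: (@le_integrable _ _ _ mu _ _ _
  (EFin \o (fun t => (K / 2^-1) * exponential_pdf 2^-1 t))) => //.
- apply/measurable_EFinP; apply: measurable_funTS.
  exact: measurable_gamma_integrand.
- move=> t; rewrite /= in_itv/= andbT => t0.
  rewrite lee_fin ger0_norm ?mulr_ge0 ?powR_ge0 ?expR_ge0//.
  rewrite exponential_pdfE; last exact: ltW.
  apply: (le_trans (hK _ t0)).
  apply: le_trans (ler_norm _); rewrite mulrA divfK ?gt_eqF//.
  by rewrite mulNr [2^-1 * t]mulrC.
- have -> : EFin \o (fun t : R => K / 2^-1 * exponential_pdf 2^-1 t)
      = (fun t => (K / 2^-1)%:E * (EFin \o exponential_pdf 2^-1) t)%E.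
    by apply/funext => t; rewrite /= EFinM.
  apply: integrableZl => //; apply: integrableS (integrable_exponential_pdf h2) => //.
Qed.

Lemma Gamma_gt0 x : 1 <= x -> 0 < Gamma x.
Proof.
move=> x1; have x10 : 0 <= x - 1 by lra.
rewrite /Gamma /Rintegral.
(* [Gamma] is the real part of an extended integral and would be 0 if that were infinite, so
   finiteness comes before any lower bound. *)
have fin : (\int[mu]_(t in `]0%R, +oo[) (t `^ (x - 1) * expR (- t))%:E \is a fin_num)%E.
  exact: (integrable_fin_num _ (integrable_gamma x10)).
rewrite -lte_fin fineK//.
(* On [[1, 2]] the power is at least 1 and the exponential at least [expR (-2)]. *)
apply: (@lt_le_trans _ _ (\int[mu]_(t in `[1%R, 2%R]) (cst (expR (-2))%:E t))%E).
  rewrite integral_cst//= lebesgue_measure_itv/= lte_fin ifT; last by lra.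
  by rewrite -EFinB -EFinM lte_fin mulr_gt0 ?expR_gt0//; lra.
apply: (@le_trans _ _ (\int[mu]_(t in `[1%R, 2%R]) (t `^ (x - 1) * expR (- t))%:E)%E).
  apply: ge0_le_integral => //.
  - by move=> t _; rewrite lee_fin expR_ge0.
  - apply/measurable_EFinP; apply: measurable_funTS.
    exact: measurable_gamma_integrand.
  - move=> t; rewrite /= in_itv/= => /andP[t1 t2]; rewrite lee_fin.
    rewrite -[leLHS]mul1r; apply: ler_pM => //.
      by rewrite -[leLHS](powRr0 t); exact: ler_powR.
    by rewrite ler_expR lerN2.
apply: ge0_subset_integral => //.
- apply/measurable_EFinP; apply: measurable_funTS.
  exact: measurable_gamma_integrand.
- by move=> t _; rewrite lee_fin mulr_ge0 ?powR_ge0 ?expR_ge0.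
- by move=> t; rewrite /= !in_itv/= andbT => /andP[t1 _]; lra.
Qed.

(* The integrand of Gamma (x + 1) - x * Gamma x is the derivative k of
   - t^x e^(-t).  It changes sign at t = x, and the range is split there because
   the fundamental theorem on [x, +oo[ requires a nonnegative integrand. *)
Lemma GammaD1 x : 1 <= x -> Gamma (x + 1) = x * Gamma x.
Proof.
move=> x1; have x0 : 0 < x by lra.
have x10 : 0 <= x - 1 by lra.
rewrite /Gamma addrK.
pose f t := t `^ x * expR (- t).
pose k t := f t - x * (t `^ (x - 1) * expR (- t)).
have dF t : 0 < t -> is_derive t 1 (- f) (k t).
  move=> t0; have h : is_derive t 1 (fun t : R => expR (- t)) (- expR (- t)).
    by apply: is_derive_eq; rewrite mulrN1.
  apply: (is_derive_eq (is_deriveN (is_deriveM (is_derive1_powR x t0) h))).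
  by rewrite /k /f /GRing.scale/=; ring.
have if0 := integrable_gamma (ltW x0).
have ig0 := integrable_gamma x10.
(* For [x = 1] the exponent [x - 1] is 0 and the power is the constant 1, also at 0; a positive
   exponent gives the limit 0 there. *)
have cont_powR a : 0 <= a -> {within `[0%R, +oo[, continuous (fun t : R => t `^ a)}.
  rewrite le_eqVlt => /predU1P[<-|a0].
    have -> : (fun t : R => t `^ 0) = cst 1 by apply/funext => t; rewrite powRr0.
    by apply: continuous_subspaceT; exact: cst_continuous.
  apply/continuous_within_itvcyP; split.
    move=> t; rewrite in_itv/= andbT => t0.
    apply: differentiable_continuous; apply/derivable1_diffP.
    by apply: derivable_powR; rewrite in_itv/= andbT.
  by rewrite powR0 ?gt_eqF//; exact: powR_cvg0.
have cexp : continuous (fun t : R => expR (- t)).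
  by move=> t; apply: continuous_comp; [exact: opp_continuous|exact: continuous_expR].
have cf : {within `[0%R, +oo[, continuous f}.
  move=> t; apply: cvgM; first exact: (cont_powR _ (ltW x0)).
  exact: (continuous_subspaceT cexp).
have ck : {within `[0%R, +oo[, continuous k}.
  move=> t; apply: cvgB; first exact: cf.
  apply: cvgM; first exact: cvg_cst.
  apply: cvgM; first exact: (cont_powR _ x10).
  exact: (continuous_subspaceT cexp).
have ik : mu.-integrable `]0, +oo[ (EFin \o k).
  have -> : EFin \o k = (fun t => ((EFin \o f) t - x%:E *
      (EFin \o (fun t => t `^ (x - 1) * expR (- t))%R) t)%E) by [].
  by apply: integrableB => //; apply: integrableZl.
apply/eqP; rewrite -subr_eq0 -RintegralZl// -RintegralB//; last first.
  have -> : EFin \o (fun t => x * (t `^ (x - 1) * expR (- t))) =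
      (fun t => (x%:E * (EFin \o (fun t => t `^ (x - 1) * expR (- t))%R) t)%E) by [].
  exact: integrableZl.
rewrite -[X in X == 0]/(\int[mu]_(t in `]0, +oo[) k t).
have f0 : f 0 = 0 by rewrite /f powR0 ?mul0r// gt_eqF.
have i1 : \int[mu]_(t in `]0, x]) k t = - f x.
  rewrite Rintegral_itv_obnd_cbnd; last first.
    apply: integrableS ik => //.
    by move=> t; rewrite /= !in_itv/= andbT => /andP[].
  rewrite /Rintegral (continuous_FTC2 (F := - f))//.
  - by rewrite -EFinB /= -[(- f) x]/(- f x) -[(- f) 0]/(- f 0) f0; ring.
  - by apply: continuous_subspaceW ck; exact: subset_itvl.
  - split.
    + by move=> t; rewrite in_itv/= => /andP[t0 _]; apply: ex_derive; exact: dF.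
    + by apply: cvgN; move/continuous_within_itvcyP : cf => -[].
    + apply: cvg_at_left_filter; apply: differentiable_continuous.
      by apply/derivable1_diffP; apply: ex_derive; exact: dF x0.
  - move=> t; rewrite in_itv/= => /andP[t0 _].
    by rewrite derive1E; exact: (@derive_val _ _ _ _ _ _ _ (dF t t0)).
have i2 : \int[mu]_(t in `]x, +oo[) k t = f x.
  rewrite Rintegral_itv_obnd_cbnd; last first.
    apply: integrableS ik => //.
    by move=> t; rewrite /= !in_itv/= !andbT; exact: lt_trans.
  rewrite (@Rintegral_ge0_continuous_FTC2y _ k (- f) x 0).
  - by rewrite -[(- f) x]/(- f x); ring.
  (* Splitting one factor [t] off the power gives [k t = (t - x) t^(x-1) e^(-t)]. *)
  - move=> t xt; rewrite /k /f -(@mulr_powRB1 _ t x)//; last by lra.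
    rewrite mulrA -mulrBl mulr_ge0 ?expR_ge0// -mulrBl.
    by rewrite mulr_ge0 ?powR_ge0//; lra.
  - apply: continuous_subspaceW ck; apply: subset_itvr.
    by rewrite bnd_simp; lra.
  - rewrite -oppr0; apply: cvgN.
    have [K hK] := @powR_le_expR x (ltW x0).
    apply: (@squeeze_cvgr _ _ _ _ (cst 0) (fun t => K * expR (- (t / 2)))).
    + near=> t; have t0 : 0 < t by [].
      by rewrite mulr_ge0 ?powR_ge0 ?expR_ge0//=; exact: hK.
    + exact: cvg_cst.
    + rewrite -(mulr0 K); apply: cvgM; first exact: cvg_cst.
      apply: (@cvg_comp _ _ _ (fun t => t / 2) (fun z => expR (- z)) _
        (pinfty_nbhs R)); last exact: cvgr_expR.
      by apply: gt0_cvgMly => //; exact: cvg_id.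
  - by move=> t xt; apply: ex_derive; exact: (dF t (lt_trans x0 xt)).
  - apply: cvg_at_right_filter; apply: differentiable_continuous.
    by apply/derivable1_diffP; apply: ex_derive; exact: dF x0.
  - move=> t; rewrite in_itv/= andbT => xt.
    by rewrite derive1E; exact: (@derive_val _ _ _ _ _ _ _ (dF t (lt_trans x0 xt))).
have := @Rintegral_itvB _ k (BRight 0) +oo%O x ik.
rewrite !bnd_simp ltW// => /(_ isT isT) /eqP; rewrite i1 i2 => /eqP h.
by apply/eqP; move: h; lra.
Unshelve. all: by end_near. Qed.

End GammaFunction.

(** * The normalised Bessel function as an entire power series *)

Section BesselSeries.
Variable R : realType.
Implicit Types (a x nu : R) (m n k : nat).

Definition poch a n : R := \prod_(i < n) (a + i%:R).

Lemma pochS a n : poch a n.+1 = poch a n * (a + n%:R).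
Proof. by rewrite /poch big_ord_recr. Qed.

Lemma poch_ge1 a n : 1 <= a -> 1 <= poch a n.
Proof.
move=> a1; elim: n => [|n IHn]; first by rewrite /poch big_ord0.
rewrite pochS -[leLHS]mulr1; apply: ler_pM => //.
by rewrite (le_trans a1)// lerDl ler0n.
Qed.

Lemma Gamma_poch a n : 1 <= a -> Gamma (n%:R + a) = poch a n * Gamma a.
Proof.
move=> a1; elim: n => [|n IHn]; first by rewrite /poch big_ord0 add0r mul1r.
have -> : n.+1%:R + a = n%:R + a + 1 by rewrite -natr1; ring.
by rewrite GammaD1 ?IHn ?pochS; [ring|rewrite (le_trans a1)// lerDr ler0n].
Qed.

Definition psi_coeff a m k : R := (k`!%:R * poch a (k + m))^-1.

(* psi a 0 (x^2 / 4) is the normalised Bessel function of order a - 1, and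
   psi a m is the m-th derivative of psi a 0. *)
Definition psi a m x : R := limn (pseries (psi_coeff a m) x).

Lemma psi_coeff_gt0 a m k : 1 <= a -> 0 < psi_coeff a m k.
Proof.
move=> a1; rewrite invr_gt0 mulr_gt0// ?ltr0n ?fact_gt0//.
exact: lt_le_trans ltr01 (poch_ge1 _ a1).
Qed.

(** The factor [k.+1] produced by differentiation cancels in the factorial of [k.+1], so only the
    Pochhammer index moves and the family is closed under differentiation. *)
Lemma pseries_diffs_psi a m : pseries_diffs (psi_coeff a m) = psi_coeff a m.+1.
Proof.
apply/funext => k; rewrite /pseries_diffs /psi_coeff factS natrM addSnnS.
by rewrite -mulrA invfM mulrA mulfV ?mul1r// pnatr_eq0.
Qed.

(** For [a >= 1] the Pochhammer factors are at least 1, so the exponential series dominates. *)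
Lemma is_cvg_psi a m x : 1 <= a -> cvgn (pseries (psi_coeff a m) x).
Proof.
move=> a1; apply: normed_cvg.
apply: series_le_cvg (is_cvg_series_exp_coeff `|x|) => n.
- exact: normr_ge0.
- exact: exp_coeff_ge0.
- rewrite /= normrM normrX /exp_coeff mulrC.
  apply: ler_wpM2l; first exact: exprn_ge0.
  rewrite gtr0_norm ?psi_coeff_gt0// lef_pV2 ?posrE ?ltr0n ?fact_gt0//.
    by rewrite ler_peMr ?ler0n ?poch_ge1.
  by rewrite -invr_gt0; exact: psi_coeff_gt0.
Qed.

Lemma is_derive_psi a m x : 1 <= a ->
  is_derive x 1 (psi a m) (psi a m.+1 x).
Proof.
move=> a1; rewrite /psi -pseries_diffs_psi.
apply: (@pseries_snd_diffs _ _ (`|x| + 1)).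
- exact: is_cvg_psi.
- by rewrite pseries_diffs_psi; exact: is_cvg_psi.
- by rewrite !pseries_diffs_psi; exact: is_cvg_psi.
- by rewrite (lt_le_trans _ (ler_norm _))// ltrDl.
Qed.

Lemma continuous_psi a m : 1 <= a -> continuous (psi a m).
Proof.
move=> a1 x; apply: differentiable_continuous; apply/derivable1_diffP.
by apply: ex_derive; exact: is_derive_psi.
Qed.

Lemma psi_ode a x : 1 <= a -> x * psi a 2 x + a * psi a 1 x = psi a 0 x.
Proof.
move=> a1.
(* The identity already holds between partial sums, provided the sum multiplied by [x] stops one
   term earlier. *)
have fin n : x * pseries (psi_coeff a 2) x n + a * pseries (psi_coeff a 1) x n.+1
    = pseries (psi_coeff a 0) x n.+1.
  rewrite /pseries /series/=; elim: n => [|n IHn].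
    rewrite !big_nat1 big_geq// mulr0 add0r !expr0 !mulr1 /psi_coeff.
    rewrite /poch !big_ord_recl !big_ord0 !fact0 addr0 !mulr1 invr1 mul1r.
    by rewrite mulfV// gt_eqF//; lra.
  rewrite [in RHS]big_nat_recr//= -IHn.
  rewrite [in X in _ * X + _]big_nat_recr//= [in X in _ + _ * X]big_nat_recr//=.
  rewrite /psi_coeff addn0 addn1 addn2 !pochS factS natrM exprS.
  have := poch_ge1 n a1; have := ler0n R n.
  set p := poch a n; rewrite -natr1 => n0 p1.
  have f0 : n`!%:R != 0 :> R by rewrite pnatr_eq0 -lt0n fact_gt0.
  field; rewrite f0 /=; apply/and4P; split; apply: lt0r_neq0; lra.
have c2 : x * pseries (psi_coeff a 2) x n
    + a * pseries (psi_coeff a 1) x n.+1 @[n --> \oo] --> x * psi a 2 x + a * psi a 1 x.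
  apply: cvgD; apply: cvgM; try exact: cvg_cst; first exact: is_cvg_psi.
  by rewrite cvg_shiftS; exact: is_cvg_psi.
move: c2; under eq_fun do rewrite fin.
rewrite (cvg_shiftS (pseries (psi_coeff a 0) x)) => c2.
by apply/esym/cvg_lim.
Qed.

Lemma psi_ge1 a x : 1 <= a -> 0 <= x -> 1 <= psi a 0 x.
Proof.
move=> a1 x0.
have -> : 1 = pseries (psi_coeff a 0) x 1.
  rewrite /pseries /series/= big_nat1 expr0 /psi_coeff fact0 /poch big_ord0.
  by rewrite !mulr1 invr1.
apply: nondecreasing_cvgn_le; last exact: is_cvg_psi.
apply: nondecreasing_series => n _ _.
by rewrite mulr_ge0 ?exprn_ge0 ?(ltW (psi_coeff_gt0 _ _ a1)).
Qed.

Lemma psi0 a : psi a 0 0 = 1.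
Proof.
apply: cvg_lim => //; apply: cvg_near_cst.
near=> n; have n0 : (0 < n)%N by near: n; exact: nbhs_infty_gt.
rewrite /pseries /series/= -(prednK n0) big_nat_recl// big1 ?addr0.
  by rewrite expr0 /psi_coeff fact0 /poch big_ord0 !mulr1 invr1.
by move=> i _; rewrite expr0n/= mulr0.
Unshelve. all: by end_near. Qed.

(** By [Gamma_poch], [(y/2)^nu / Gamma (nu + 1)] factors out of every term of the Bessel series, and
    it is the inverse of the normalising prefactor. Both sides are even, and the default value at 0
    agrees with [psi0]. *)
Lemma besselI_normE nu x : 0 <= nu ->
  besselI_norm nu x = psi (nu + 1) 0 (x ^+ 2 / 4).
Proof.
move=> nu0; have a1 : 1 <= nu + 1 by lra.
rewrite /besselI_norm; case: eqVneq => [->|x0].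
  by rewrite expr0n/= mul0r psi0.
rewrite -(real_normK (num_real x)).
have : 0 < `|x| by rewrite normr_gt0.
move: `|x| => y y0 {x x0}.
have y2 : 0 < y / 2 by lra.
have G0 : Gamma (nu + 1) != 0 by rewrite gt_eqF ?Gamma_gt0.
have -> : besselI nu y = (y / 2) `^ nu / Gamma (nu + 1) * psi (nu + 1) 0 (y ^+ 2 / 4).
  rewrite /besselI; set u := fun k : nat => _.
  have -> : series u = (fun n => (y / 2) `^ nu / Gamma (nu + 1)
      * pseries (psi_coeff (nu + 1) 0) (y ^+ 2 / 4) n).
    apply/funext => n; rewrite /pseries /series/= big_distrr/=.
    apply: eq_bigr => k _; rewrite /u /psi_coeff addn0 -addrA Gamma_poch//.
    rewrite powRD ?(gt_eqF y2) ?implybT// powR_mulrn ?ltW// -mul2n exprM.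
    have -> : (y / 2) ^+ 2 = y ^+ 2 / 4 by field.
    have p0 : poch (nu + 1) k != 0.
      by rewrite gt_eqF// (lt_le_trans ltr01)// poch_ge1.
    have f0 : k`!%:R != 0 :> R by rewrite pnatr_eq0 -lt0n fact_gt0.
    by field; rewrite f0 p0 G0.
  apply: cvg_lim => //; apply: cvgM; first exact: cvg_cst.
  exact: is_cvg_psi.
have q0 : (y / 2) `^ nu != 0 by rewrite gt_eqF// powR_gt0.
have -> : (2 / y) `^ nu = ((y / 2) `^ nu)^-1.
  apply: (mulIf q0); rewrite mulVf// -powRM ?ltW ?divr_gt0//.
  by rewrite (_ : 2 / y * (y / 2) = 1) ?powR1//; field; rewrite gt_eqF.
by field; rewrite G0 q0.
Qed.

End BesselSeries.

(** * Differentiation rules for functions of one variable *)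

Section DerivationRules.
Variable R : realType.
Implicit Types (f g : R -> R) (c t u v : R).

Lemma is_derive_addf f g t u v : is_derive t 1 f u -> is_derive t 1 g v ->
  is_derive t 1 (fun r => f r + g r) (u + v).
Proof. by move=> df dg; exact: is_deriveD. Qed.

Lemma is_derive_subf f g t u v : is_derive t 1 f u -> is_derive t 1 g v ->
  is_derive t 1 (fun r => f r - g r) (u - v).
Proof. by move=> df dg; exact: is_deriveB. Qed.

Lemma is_derive_mulf f g t u v : is_derive t 1 f u -> is_derive t 1 g v ->
  is_derive t 1 (fun r => f r * g r) (u * g t + f t * v).
Proof.
by move=> df dg; apply: (is_derive_eq (is_deriveM df dg)); rewrite addrC mulrC.
Qed.

Lemma is_derive_scalef c f t u : is_derive t 1 f u ->
  is_derive t 1 (fun r => c * f r) (c * u).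
Proof. by move=> df; exact: is_deriveZ. Qed.

Lemma is_derive_compf f g t u v : is_derive t 1 g u -> is_derive (g t) 1 f v ->
  is_derive t 1 (fun r => f (g r)) (v * u).
Proof. by move=> dg df; exact: is_derive1_comp. Qed.

Lemma is_derive_linexp c t :
  is_derive t 1 (fun t => expR (c * t)) (c * expR (c * t)).
Proof. by apply: is_derive_eq; rewrite /GRing.scale/= mulr1 mulrC. Qed.

End DerivationRules.

(** * Partial derivatives and the chain rule along a graph *)

Section PartialDerivatives.
Variable R : realType.
Implicit Types (g : R * R -> R) (s : R * R) (f df phi : R -> R).
Implicit Types (v t h e dphi : R) (D : set (R * R)).

Lemma is_derive_slice1 g s v :
  is_derive s (1, 0) g v <-> is_derive s.1 1 (fun t => g (t, s.2)) v.
Proof.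
have e : (fun h : R => h^-1 *: ((g \o shift s) (h *: (1, 0)) - g s)) =
    (fun h => h^-1 *: (((fun t => g (t, s.2)) \o shift s.1) (h *: 1) - g (s.1, s.2))).
  apply/funext => h; rewrite /= -surjective_pairing; congr (_ *: (g _ - _)).
  by rewrite [LHS]surjective_pairing /= scaler0 add0r.
split=> -[dg <-]; (apply: DeriveDef; first by move: dg; rewrite /derivable e).
  by rewrite /derive e.
by rewrite /derive e.
Qed.

Lemma is_derive_slice2 g s v :
  is_derive s (0, 1) g v <-> is_derive s.2 1 (fun t => g (s.1, t)) v.
Proof.
have e : (fun h : R => h^-1 *: ((g \o shift s) (h *: (0, 1)) - g s)) =
    (fun h => h^-1 *: (((fun t => g (s.1, t)) \o shift s.2) (h *: 1) - g (s.1, s.2))).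
  apply/funext => h; rewrite /= -surjective_pairing; congr (_ *: (g _ - _)).
  by rewrite [LHS]surjective_pairing /= scaler0 add0r.
split=> -[dg <-]; (apply: DeriveDef; first by move: dg; rewrite /derivable e).
  by rewrite /derive e.
by rewrite /derive e.
Qed.

Lemma D1_val g s v :
  is_derive s.1 1 (fun t => g (t, s.2)) v -> D1 g s = v.
Proof. by move=> d; apply: derive_val; apply/is_derive_slice1. Qed.

Lemma D2_val g s v :
  is_derive s.2 1 (fun t => g (s.1, t)) v -> D2 g s = v.
Proof. by move=> d; apply: derive_val; apply/is_derive_slice2. Qed.

(** The mean value theorem for increments of either sign, with derivatives assumed only in a ball so
    that it applies to short segments inside a domain. *)
Lemma is_derive_increment f df t e h :
  (forall r, `|t - r| < e -> is_derive r 1 f (df r)) -> `|h| < e ->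
  exists2 c, `|t - c| < e & f (h + t) - f t = df c * h.
Proof.
move=> fdf he.
have cont a c : `|t - a| < e -> `|t - c| < e -> {within `[a, c], continuous f}.
  move=> ta tc; apply: derivable_within_continuous => r.
  rewrite in_itv/= => /andP[ar rc]; apply: ex_derive; apply: fdf.
  by move: ta tc; rewrite !ltr_norml; lra.
have t0 : `|t - t| < e by rewrite subrr normr0 (le_lt_trans _ he).
have th : `|t - (h + t)| < e by rewrite opprD addrCA subrr addr0 normrN.
have d r a c : `|t - a| < e -> `|t - c| < e -> r \in `]a, c[ ->
    is_derive r 1 f (df r).
  move=> ta tc; rewrite in_itv/= => /andP[ar rc]; apply: fdf.
  by move: ta tc; rewrite !ltr_norml; lra.
have [h0|h0] := leP 0 h.
  have [|r rt||c] := @MVT_segment R f df t (h + t); first by lra.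
  - exact: d rt.
  - exact: cont.
  - rewrite in_itv/= => /andP[tc ct] E; exists c; last by rewrite E; ring.
    by move: he; rewrite !ltr_norml; lra.
have [|r rt||c] := @MVT_segment R f df (h + t) t; first by lra.
- exact: d rt.
- exact: cont.
- rewrite in_itv/= => /andP[tc ct] E; exists c.
    by move: he; rewrite !ltr_norml; lra.
  by rewrite -opprB E; ring.
Qed.

(* Splitting g (r, phi r) = (g (r, phi r) - g (t, phi r)) + g (t, phi r), the
   first summand is handled by the mean value theorem and the continuity of
   D1 g, so no Frechet differentiability is needed. *)
Lemma is_derive_graph D g phi dphi t : open D -> C1_on D g ->
  D (t, phi t) -> is_derive t 1 phi dphi ->
  is_derive t 1 (fun r => g (r, phi r))
    (D1 g (t, phi t) + dphi * D2 g (t, phi t)).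
Proof.
move=> oD gC1 Dt dp; have [_ dg2 cg1 _] := gC1 _ Dt.
have cphi : {for t, continuous phi}.
  by apply: differentiable_continuous; apply/derivable1_diffP; apply: ex_derive.
pose q r := g (r, phi r) - g (t, phi r).
have -> : (fun r => g (r, phi r)) = q + (fun r => g (t, phi r)).
  by apply/funext => r; rewrite /q /GRing.add/= subrK.
apply: is_deriveD; last first.
  rewrite mulrC.
  have dg : is_derive (phi t) 1 (fun r => g (t, r)) (D2 g (t, phi t)).
    by apply/(is_derive_slice2 g (t, phi t)); exact: derivableP.
  exact: (@is_derive1_comp _ (fun r => g (t, r)) phi).
have lim : (fun h : R => h^-1 *: ((q \o shift t) (h *: 1) - q t)) @ 0^' -->
    D1 g (t, phi t).
  apply/cvgrPdist_le => eps eps0.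
  have : nbhs (t, phi t) ([set s | `|D1 g (t, phi t) - D1 g s| <= eps] `&` D).
    apply: filterI; last exact: open_nbhs_nbhs.
    by move/cvgrPdist_le : cg1 => /(_ _ eps0).
  (* A product neighbourhood whose first factor contains a ball contains the whole horizontal
     segment at height [phi (h + t)] to which the mean value theorem is applied. *)
  case=> -[A B] /= [/nbhs_ballP[e e0 tA] nB] AB.
  have {}cphi : phi (h + t) @[h --> 0^'] --> phi t.
    have : h + t @[h --> (0 : R)^'] --> 0 + t.
      by apply: cvgD; [exact: cvg_within|exact: cvg_cst].
    by rewrite add0r => sh; apply: (cvg_comp (fun h => h + t) phi sh cphi).
  near=> h.
  have h0 : h != 0 by near: h; exact: nbhs_dnbhs_neq.
  have Bh : B (phi (h + t)) by near: h; exact: cphi.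
  have he : `|h| < e by near: h; apply: dnbhs0_lt.
  have [r tr|c tc E] :=
    @is_derive_increment (fun r => g (r, phi (h + t))) (fun r => D1 g (r, phi (h + t))) t e h _ he.
    have [|_ /= Dr] := AB (r, phi (h + t)); first by split=> //; exact: tA.
    apply/(is_derive_slice1 g (r, phi (h + t))); apply: derivableP.
    have [dr _ _ _] := gC1 _ Dr; exact: dr.
  have [|/= + _] := AB (c, phi (h + t)); first by split=> //; exact: tA.
  rewrite /q /= [h%:A]mulr1 subrr subr0 E.
  by rewrite /GRing.scale/= mulrC mulfK.
by apply: DeriveDef; [apply/cvg_ex; eexists; exact: lim|exact: cvg_lim lim].
Unshelve. all: by end_near. Qed.

Lemma is_derive0_convex_cst (P : set R) f :
  (forall x y z, P x -> P y -> x <= z -> z <= y -> P z) ->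
  (forall x, P x -> is_derive x 1 f 0) ->
  forall x y, P x -> P y -> f x = f y.
Proof.
move=> Pc f0 x y.
wlog xy : x y / x <= y.
  move=> H Px Py; have [xy|/ltW yx] := leP x y; first exact: H.
  by apply/esym; exact: H.
move=> Px Py.
have dP z : x <= z -> z <= y -> is_derive z 1 f 0.
  by move=> xz zy; apply: f0; exact: Pc xz zy.
have [z|| c _] := @MVT_segment R f (cst 0) x y xy.
- by rewrite in_itv/= => /andP[/ltW xz /ltW zy]; exact: dP.
- apply: derivable_within_continuous => z; rewrite in_itv/= => /andP[xz zy].
  by apply: ex_derive; exact: dP.
by rewrite mul0r => /eqP; rewrite subr_eq0 => /eqP.
Qed.

End PartialDerivatives.

(** * The domain [U], its closure, and functions that agree on [U] *)

Section Domain.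
Variable R : realType.
Implicit Types (g k : R * R -> R) (s : R * R).

Lemma open_U : open (@U R).
Proof.
rewrite /U (_ : [set s | _] = (fun s : R * R => s.1 ^+ 2 - 4 * s.2) @^-1` [set r | 0 < r]).
  apply: open_comp; last exact: open_gt.
  move=> s _; apply: cvgB; first exact: (cvgM cvg_fst cvg_fst).
  by apply: cvgM; [exact: cvg_cst|exact: cvg_snd].
by apply/seteqP; split=> s /=; rewrite subr_gt0.
Qed.

(** Lowering the second coordinate by any positive amount moves the point into [U]. *)
Lemma closure_U s : 4 * s.2 <= s.1 ^+ 2 -> closure (@U R) s.
Proof.
case: s => x y /= xy S [[A B] /= [nA /nbhs_ballP[e e0 eB]] AB].
exists (x, y - e / 2); split; first by rewrite /U/=; move: e0 => /= e0; lra.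
apply: AB; split=> /=; first exact: nbhs_singleton.
by apply: eB; rewrite /ball/= opprB addrC subrK gtr0_norm; move: e0 => /= e0; lra.
Qed.

Lemma fmap_U_eq g k s : (forall s, U s -> g s = k s) ->
  g @ within (@U R) (nbhs s) = k @ within (@U R) (nbhs s).
Proof.
move=> gk; apply/seteqP; split; apply: near_eq_cvg; rewrite near_withinE;
  by near=> r => /gk.
Unshelve. all: by end_near. Qed.

Lemma cvg_U g s : {for s, continuous g} -> g @ within (@U R) (nbhs s) --> g s.
Proof. by move=> gc; apply: cvg_trans gc; apply: cvg_app; exact: cvg_within. Qed.

(** Membership in the closure makes [within U (nbhs s)] a proper filter, so that the limit is
    unique. *)
Lemma extU_eq g k s : (forall s, U s -> g s = k s) -> {for s, continuous k} ->
  4 * s.2 <= s.1 ^+ 2 -> extU g s = k s.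
Proof.
move=> gk kc /closure_U sU; rewrite /extU; apply: cvg_lim => //; rewrite (fmap_U_eq _ gk).
exact: cvg_U.
Qed.

Lemma D1_U_eq g k s : (forall s, U s -> g s = k s) -> U s -> D1 g s = D1 k s.
Proof.
move=> gk sU; apply: near_eq_derive; apply: filterS (open_nbhs_nbhs _) => //.
- by move=> r; exact: gk.
- by split=> //; exact: open_U.
Qed.

Lemma D2_U_eq g k s : (forall s, U s -> g s = k s) -> U s -> D2 g s = D2 k s.
Proof.
move=> gk sU; apply: near_eq_derive; apply: filterS (open_nbhs_nbhs _) => //.
- by move=> r; exact: gk.
- by split=> //; exact: open_U.
Qed.

Lemma C1_on_U_eq g k : (forall s, U s -> g s = k s) -> C1_on (@U R) k ->
  C1_on (@U R) g.
Proof.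
move=> gk kC1 s sU; have [d1 d2 c1 c2] := kC1 s sU.
have nU : nbhs s (@U R) by apply: open_nbhs_nbhs; split=> //; exact: open_U.
have kg : {near s, k =1 g} by apply: filterS nU => r /gk.
have k1 : {near s, D1 k =1 D1 g} by apply: filterS nU => r /(D1_U_eq gk).
have k2 : {near s, D2 k =1 D2 g} by apply: filterS nU => r /(D2_U_eq gk).
split.
- exact: near_eq_derivable d1.
- exact: near_eq_derivable d2.
- rewrite /prop_for /continuous_at (D1_U_eq gk sU).
  by apply: cvg_trans c1; apply: near_eq_cvg; exact: k1.
- rewrite /prop_for /continuous_at (D2_U_eq gk sU).
  by apply: cvg_trans c2; apply: near_eq_cvg; exact: k2.
Qed.

(** Since [U] is open, partial derivatives at its points depend on the values in [U] alone, as
    [extU] does by definition. This lets the smooth [ksol] stand in for [gsol]. *)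
Lemma solution_U_eq beta b g k : (forall s, U s -> g s = k s) ->
  solution beta b k -> solution beta b g.
Proof.
move=> gk [[kC1 k1C1 k2C1] pde c0 e0 de0].
have g1 s : U s -> D1 g s = D1 k s by exact: D1_U_eq.
have g2 s : U s -> D2 g s = D2 k s by exact: D2_U_eq.
have ext s : extU g s = extU k s by rewrite /extU (fmap_U_eq _ gk).
split.
- by split; [exact: C1_on_U_eq kC1|exact: C1_on_U_eq k1C1|exact: C1_on_U_eq k2C1].
- move=> s sU; rewrite (g1 s sU) (g2 s sU) (D1_U_eq g1 sU).
  by rewrite !(D2_U_eq g2 sU) (D2_U_eq g1 sU); exact: pde.
- by rewrite (fmap_U_eq _ gk).
- by rewrite ext.
- by under eq_fun do rewrite ext.
Qed.

End Domain.

(** * The three-constant family of explicit solutions *)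

Section ExplicitSolutions.
Variable R : realType.
Variables (a b : R).
Hypothesis a1 : 1 <= a.
Implicit Types (s : R * R) (A B C : R) (m : nat).

(** The value of [x ^+ 2 / 4] at the Bessel argument [x] of [gsol]; as a polynomial it makes sense
    on both sides of the boundary. *)
Definition bessel_arg s : R := b ^+ 2 / 4 * (s.1 ^+ 2 - 4 * s.2).
Definition bess m s : R := expR (b * s.1) * psi a m (bessel_arg s).

Lemma is_derive1_bess m s :
  is_derive s (1, 0) (bess m) (b * bess m s + b ^+ 2 / 2 * (s.1 * bess m.+1 s)).
Proof.
apply/is_derive_slice1; rewrite /bess /bessel_arg/=.
have darg : is_derive s.1 1 (fun t : R => b ^+ 2 / 4 * (t ^+ 2 - 4 * s.2))
    (b ^+ 2 / 2 * s.1).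
  by apply: is_derive_eq; rewrite /GRing.scale/=; field.
have := is_deriveM (is_derive_linexp b s.1)
  (@is_derive1_comp _ _ _ _ _ _ (is_derive_psi m _ a1) darg).
move=> h; apply: (is_derive_eq h); rewrite /GRing.scale/=; ring.
Qed.

Lemma is_derive2_bess m s :
  is_derive s (0, 1) (bess m) (- b ^+ 2 * bess m.+1 s).
Proof.
apply/is_derive_slice2; rewrite /bess /bessel_arg/=.
have darg : is_derive s.2 1 (fun t : R => b ^+ 2 / 4 * (s.1 ^+ 2 - 4 * t))
    (- b ^+ 2).
  by apply: is_derive_eq; rewrite /GRing.scale/=; field.
have := is_deriveM (is_derive_cst (expR (b * s.1)) s.2 1)
  (@is_derive1_comp _ _ _ _ _ _ (is_derive_psi m _ a1) darg).
move=> h; apply: (is_derive_eq h); rewrite /GRing.scale/=; ring.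
Qed.

Lemma continuous_bessel_arg : continuous bessel_arg.
Proof.
move=> s; apply: cvgM; first exact: cvg_cst.
apply: cvgB; first exact: (cvgM cvg_fst cvg_fst).
by apply: cvgM; [exact: cvg_cst|exact: cvg_snd].
Qed.

Lemma continuous_exp1 (c : R) : continuous (fun s : R * R => expR (c * s.1)).
Proof.
move=> s; apply: (cvg_comp (fun s : R * R => c * s.1) expR); last exact: continuous_expR.
by apply: cvgM; [exact: cvg_cst|exact: cvg_fst].
Qed.

Lemma continuous_bess m : continuous (bess m).
Proof.
move=> s; apply: cvgM; first exact: continuous_exp1.
apply: (cvg_comp bessel_arg (psi a m)); first exact: continuous_bessel_arg.
exact: continuous_psi.
Qed.

(** With [t = s.1], this is [e^(bt) (A e^(bt) + B e^(-bt) + C psi)], the shape that separation of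
    variables yields. *)
Definition ksol A B C s : R := A * expR (2 * b * s.1) + B + C * bess 0 s.

(** Closed forms of the partial derivatives. Both mixed ones occur because [C2_on] constrains
    [D2 (D1 g)] and [D1 (D2 g)] separately. *)
Let k1 A C s : R := A * (2 * b * expR (2 * b * s.1))
  + C * (b * bess 0 s + b ^+ 2 / 2 * (s.1 * bess 1 s)).
Let k2 C s : R := C * (- b ^+ 2 * bess 1 s).
Let k11 A C s : R := A * ((2 * b) ^+ 2 * expR (2 * b * s.1))
  + C * (b * (b * bess 0 s + b ^+ 2 / 2 * (s.1 * bess 1 s))
    + b ^+ 2 / 2 * (bess 1 s + s.1 * (b * bess 1 s + b ^+ 2 / 2 * (s.1 * bess 2 s)))).
Let k21 C s : R := C * (b * (- b ^+ 2 * bess 1 s)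
  + b ^+ 2 / 2 * (s.1 * (- b ^+ 2 * bess 2 s))).
Let k12 C s : R := C * (- b ^+ 2 * (b * bess 1 s + b ^+ 2 / 2 * (s.1 * bess 2 s))).
Let k22 C s : R := C * (b ^+ 4 * bess 2 s).

Lemma is_derive_exp1 (c : R) s :
  is_derive s (1, 0) (fun s => expR (c * s.1)) (c * expR (c * s.1)).
Proof. by apply/is_derive_slice1; exact: is_derive_linexp. Qed.

Lemma is_derive_exp2 (c : R) s :
  is_derive s (0, 1) (fun s => expR (c * s.1)) 0.
Proof.
apply/is_derive_slice2; exact: (is_derive_cst (expR (c * s.1)) s.2 1). Qed.

Lemma is_derive_fst1 s : is_derive s (1, 0) fst (1 : R).
Proof. by apply/is_derive_slice1; exact: is_derive_id. Qed.

Lemma is_derive_fst2 s : is_derive s (0, 1) fst (0 : R).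
Proof. by apply/is_derive_slice2; exact: (is_derive_cst s.1 s.2 1). Qed.

Local Existing Instance is_derive1_bess.
Local Existing Instance is_derive2_bess.
Local Existing Instance is_derive_exp1.
Local Existing Instance is_derive_exp2.
Local Existing Instance is_derive_fst1.
Local Existing Instance is_derive_fst2.

Lemma is_derive1_ksol A B C s : is_derive s (1, 0) (ksol A B C) (k1 A C s).
Proof.
rewrite /ksol; apply: is_derive_eq.
by rewrite /k1 /GRing.scale/=; ring.
Qed.

Lemma is_derive2_ksol A B C s : is_derive s (0, 1) (ksol A B C) (k2 C s).
Proof. by rewrite /ksol; apply: is_derive_eq; rewrite /k2 /GRing.scale/=; ring. Qed.

Lemma is_derive1_k1 A C s : is_derive s (1, 0) (k1 A C) (k11 A C s).
Proof. by rewrite /k1; apply: is_derive_eq; rewrite /k11 /GRing.scale/=; ring. Qed.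

Lemma is_derive2_k1 A C s : is_derive s (0, 1) (k1 A C) (k21 C s).
Proof. by rewrite /k1; apply: is_derive_eq; rewrite /k21 /GRing.scale/=; ring. Qed.

Lemma is_derive1_k2 C s : is_derive s (1, 0) (k2 C) (k12 C s).
Proof. by rewrite /k2; apply: is_derive_eq; rewrite /k12 /GRing.scale/=; ring. Qed.

Lemma is_derive2_k2 C s : is_derive s (0, 1) (k2 C) (k22 C s).
Proof. by rewrite /k2; apply: is_derive_eq; rewrite /k22 /GRing.scale/=; ring. Qed.

Lemma C1_on_is_derive (D : set (R * R)) (g d1 d2 : R * R -> R) :
  (forall s, is_derive s (1, 0) g (d1 s)) ->
  (forall s, is_derive s (0, 1) g (d2 s)) ->
  continuous d1 -> continuous d2 -> C1_on D g.
Proof.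
move=> h1 h2 c1 c2 s _.
have -> : D1 g = d1 by apply/funext => r; exact: derive_val.
have -> : D2 g = d2 by apply/funext => r; exact: derive_val.
by split; [exact: ex_derive|exact: ex_derive|exact: c1|exact: c2].
Qed.

Lemma continuous_add (f g : R * R -> R) : continuous f -> continuous g ->
  continuous (fun s => f s + g s).
Proof. by move=> cf cg s; exact: (cvgD (cf s) (cg s)). Qed.

Lemma continuous_mul (f g : R * R -> R) : continuous f -> continuous g ->
  continuous (fun s => f s * g s).
Proof. by move=> cf cg s; exact: (cvgM (cf s) (cg s)). Qed.

Lemma continuous_const (c : R) : continuous (fun _ : R * R => c).
Proof. by move=> s; exact: cvg_cst. Qed.

Lemma continuous_fst : continuous (fun s : R * R => s.1).
Proof. by move=> s; exact: cvg_fst. Qed.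

Ltac continuity := rewrite /ksol /k1 /k2 /k11 /k12 /k21 /k22;
  repeat first [simple apply continuous_const | simple apply continuous_fst
    | simple apply continuous_exp1 | simple apply continuous_bess
    | simple apply continuous_add | simple apply continuous_mul].

Lemma continuous_ksol A B C : continuous (ksol A B C).
Proof. by continuity. Qed.

Lemma extU_ksol (g : R * R -> R) A B C s : (forall s, U s -> g s = ksol A B C s) ->
  4 * s.2 <= s.1 ^+ 2 -> extU g s = ksol A B C s.
Proof. by move=> gk; apply: extU_eq => //; exact: continuous_ksol. Qed.

Lemma ksol00 A B C : ksol A B C (0, 0) = A + B + C.
Proof.
by rewrite /ksol /bess /bessel_arg/= expr0n/= !mulr0 subr0 mulr0 psi0 expR0 !mulr1.
Qed.

Lemma is_derive_extU_ksol (g : R * R -> R) A B C :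
  (forall s, U s -> g s = ksol A B C s) ->
  is_derive (0 : R) 1 (fun x : R => extU g (x, 0)) (2 * b * A + b * C).
Proof.
move=> gk.
have -> : (fun x : R => extU g (x, 0)) = (fun x => ksol A B C (x, 0)).
  by apply/funext => x; apply: extU_ksol => //=; rewrite mulr0 sqr_ge0.
have /is_derive_slice1/= h := is_derive1_ksol A B C (0, 0).
apply: (is_derive_eq h).
rewrite /k1 /bess /bessel_arg/= expr0n/= !mulr0 subr0 mulr0 psi0 expR0 mul0r.
by rewrite mulr0; ring.
Qed.

Lemma ksol_solution (beta : nat) A B C : b != 0 -> a = (beta%:R + 1) / 2 ->
  A + B + C = 0 -> 2 * b * A + b * C = (2 * b)^-1 ->
  solution beta b (ksol A B C).
Proof.
move=> b0 ab ABC dABC.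
have E1 : D1 (ksol A B C) = k1 A C.
  by apply/funext => s; exact: (@derive_val _ _ _ _ _ _ _ (is_derive1_ksol A B C s)).
have E2 : D2 (ksol A B C) = k2 C.
  by apply/funext => s; exact: (@derive_val _ _ _ _ _ _ _ (is_derive2_ksol A B C s)).
split.
- rewrite /C2_on E1 E2; split.
  + apply: C1_on_is_derive (is_derive1_ksol A B C) (is_derive2_ksol A B C) _ _.
      by continuity.
    by continuity.
  + apply: C1_on_is_derive (is_derive1_k1 A C) (is_derive2_k1 A C) _ _.
      by continuity.
    by continuity.
  + apply: C1_on_is_derive (is_derive1_k2 C) (is_derive2_k2 C) _ _.
      by continuity.
    by continuity.
- move=> s _; rewrite E1 E2.
  rewrite (_ : D1 (k1 A C) s = k11 A C s); last first.
    exact: (@derive_val _ _ _ _ _ _ _ (is_derive1_k1 A C s)).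
  rewrite (_ : D2 (k1 A C) s = k21 C s); last first.
    exact: (@derive_val _ _ _ _ _ _ _ (is_derive2_k1 A C s)).
  rewrite (_ : D2 (k2 C) s = k22 C s); last first.
    exact: (@derive_val _ _ _ _ _ _ _ (is_derive2_k2 C s)).
  split; last by rewrite /k21 /k22 /k2; field.
  (* The second equation is a formal identity; the first one reduces to [psi_ode] at
     [bessel_arg s]. *)
  have : bess 0 s = bessel_arg s * bess 2 s + a * bess 1 s.
    by rewrite /bess -(psi_ode (bessel_arg s) a1); ring.
  by rewrite /k11 /k22 /k1 /k2 /bessel_arg ab => ->; field.
- apply/cvg_ex; exists (ksol A B C (0, 0)); apply: cvg_U.
  exact: continuous_ksol.
- by rewrite (@extU_ksol _ A B C) ?ksol00//=; rewrite mulr0 sqr_ge0.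
- by rewrite -dABC; exact: is_derive_extU_ksol.
Qed.

(** The bound on [s] allows the square root to be squared away; [Num.sqrt] returns 0 on negative
    numbers. *)
Lemma gsol_ksol (beta : nat) (C : R) s : a = (beta%:R + 1) / 2 ->
  4 * s.2 <= s.1 ^+ 2 ->
  gsol beta b C s = ksol ((1 - C) / (2 * b ^+ 2)) (- C / (2 * b ^+ 2))
    ((2 * C - 1) / (2 * b ^+ 2)) s.
Proof.
move=> ab sU; have nu0 : 0 <= (beta%:R - 1) / 2 :> R by have := a1; rewrite ab; lra.
rewrite /gsol /ksol /bess besselI_normE//.
have -> : (beta%:R - 1) / 2 + 1 = a by rewrite ab; field.
rewrite exprMn sqr_sqrtr ?subr_ge0//.
have -> : b ^+ 2 * (s.1 ^+ 2 - 4 * s.2) / 4 = bessel_arg s by rewrite /bessel_arg; ring.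
by ring.
Qed.

End ExplicitSolutions.

(** * The two ordinary differential equations left after separation *)

Section OrdinaryDifferentialEquations.
Variable R : realType.
Implicit Types (f g h F : R -> R) (b c t u v : R).

(** The operator factors: for [c = b] and [c = - b] the function [e^(-ct) (F' + c F)] is constant.
    The difference of the two resulting formulas is [2 * b * F]. *)
Lemma ode_exp b F F1 F2 : b != 0 ->
  (forall t, is_derive t 1 F (F1 t)) -> (forall t, is_derive t 1 F1 (F2 t)) ->
  (forall t, F2 t = b ^+ 2 * F t) ->
  exists A B, forall t, F t = A * expR (b * t) + B * expR (- (b * t)).
Proof.
move=> b0 dF dF1 F2E.
have key c t : c ^+ 2 = b ^+ 2 ->
    expR (- c * t) * (F1 t + c * F t) = F1 0 + c * F 0.
  move=> cb; transitivity (expR (- c * 0) * (F1 0 + c * F 0)).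
    apply: (@is_derive_0_is_cst _ (fun t => expR (- c * t) * (F1 t + c * F t))).
    move=> {}t; have e := is_derive_linexp (- c) t.
    have := is_derive_mulf e (is_derive_addf (dF1 t) (is_derive_scalef c (dF t))).
    by move=> d; apply: (is_derive_eq d); rewrite F2E -cb; ring.
  by rewrite mulr0 expR0 mul1r.
have [A EA] : exists A, forall t, F1 t + b * F t = A * expR (b * t).
  exists (F1 0 + b * F 0) => t; rewrite -(key b t)// mulrAC mulNr expRN.
  by rewrite mulVf ?mul1r// gt_eqF// expR_gt0.
have [B EB] : exists B, forall t, F1 t - b * F t = B * expR (- (b * t)).
  exists (F1 0 + - b * F 0) => t; rewrite -(key (- b) t) ?sqrrN//.
  rewrite mulrAC opprK expRN mulfV ?mul1r ?mulNr//.
  by rewrite gt_eqF// expR_gt0.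
exists (A / (2 * b)), (- B / (2 * b)) => t.
rewrite mulrAC -EA [- B / _ * _]mulrAC mulNr -EB; field.
by rewrite b0.
Qed.

Section Bessel.
Variables (a c : R).
Hypotheses (a1 : 1 <= a) (c0 : 0 <= c).

(** The solution of [u h'' + a h' = c h] that is regular at 0, followed by its derivatives. *)
Let y u := psi a 0 (c * u).
Let y1 u := c * psi a 1 (c * u).
Let y2 u := c ^+ 2 * psi a 2 (c * u).

Let dy u : is_derive u 1 y (y1 u).
Proof.
have dc : is_derive u 1 (fun u => c * u) c.
  by apply: is_derive_eq; rewrite /GRing.scale/= mulr1.
have d := is_derive_compf dc (is_derive_psi 0 (c * u) a1).
by apply: (is_derive_eq d); rewrite mulrC.
Qed.

Let dy1 u : is_derive u 1 y1 (y2 u).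
Proof.
have dc : is_derive u 1 (fun u => c * u) c.
  by apply: is_derive_eq; rewrite /GRing.scale/= mulr1.
have d := is_derive_scalef c (is_derive_compf dc (is_derive_psi 1 (c * u) a1)).
by apply: (is_derive_eq d); rewrite /y2; ring.
Qed.

Let y_ge1 u : 0 < u -> 1 <= y u.
Proof. by move=> u0; apply: psi_ge1 => //; rewrite mulr_ge0// ltW. Qed.

(** Abel's identity: the Wronskian satisfies [W' = - (a / u) W], and [expR (a * ln u)] is the
    integrating factor [u^a]. *)
Let wronskian_cst h h1 h2 :
  (forall u, 0 < u -> is_derive u 1 h (h1 u)) ->
  (forall u, 0 < u -> is_derive u 1 h1 (h2 u)) ->
  (forall u, 0 < u -> u * h2 u + a * h1 u = c * h u) ->
  exists w, forall u, 0 < u -> (h1 u * y u - h u * y1 u) * expR (a * ln u) = w.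
Proof.
move=> dh dh1 ode.
exists ((h1 1 * y 1 - h 1 * y1 1) * expR (a * ln 1)) => u u0.
pose P (u : R) := 0 < u.
apply: (@is_derive0_convex_cst _ P
  (fun u => (h1 u * y u - h u * y1 u) * expR (a * ln u))) => //; last exact: ltr01.
  by move=> s t r s0 _ sr _; exact: lt_le_trans sr.
move=> t t0.
have de : is_derive t 1 (fun u => expR (a * ln u)) (expR (a * ln t) * (a * t^-1)).
  have dl := is_derive_scalef a (is_derive1_ln t0).
  exact: (is_derive_compf dl (is_derive_expR (a * ln t))).
have d := is_derive_mulf (is_derive_subf (is_derive_mulf (dh1 t t0) (dy t))
  (is_derive_mulf (dh t t0) (dy1 t))) de.
apply: (is_derive_eq d).
have yE : t * y2 t + a * y1 t = c * y t.
  by rewrite /y -(psi_ode (c * t) a1) /y1 /y2; ring.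
have {}ode := ode t t0.
have t0' : t != 0 by rewrite gt_eqF.
have -> : h2 t = (c * h t - a * h1 t) / t by rewrite -ode; field.
have -> : y2 t = (c * y t - a * y1 t) / t by rewrite -yE; field.
by field.
Qed.

(* If h is not a multiple of y, then (h/y)' = W/y^2 with a Wronskian W of
   order u^-a, a >= 1, and h/y diverges logarithmically at 0. *)
Let wronskian_le0 h h1 (M w : R) :
  (forall u, 0 < u -> is_derive u 1 h (h1 u)) ->
  (\forall u \near 0^'+, `|h u| <= M) ->
  (forall u, 0 < u -> (h1 u * y u - h u * y1 u) * expR (a * ln u) = w) ->
  w <= 0.
Proof.
move=> dh hM wE; rewrite leNgt; apply/negP => w0.
have ycont : {for 0, continuous y}.
  by apply: differentiable_continuous; apply/derivable1_diffP; apply: ex_derive.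
have y0 : y 0 = 1 by rewrite /y mulr0 psi0.
have [e e0 ye] : exists2 e, 0 < e & forall u, 0 < u -> u < e -> y u <= 2.
  have /nbhs_ballP[e /= e0 ye] : \forall u \near (0 : R), y u < 2.
    have y02 : y 0 < 2 by rewrite y0; lra.
    exact: (cvgr_lt _ ycont _ y02).
  exists e => // u u0 ue; apply/ltW; apply: ye.
  by rewrite /ball/= sub0r normrN gtr0_norm.
(* Up to [d], [y <= 2] bounds [y^-2] below by 1/4, and [u <= 1] gives [u^-a >= u^-1]; hence
   [(h / y)' >= (w / 4) / u] there. *)
pose d := Num.min e 1 / 2.
have [d0 de d1] : [/\ 0 < d, d < e & d <= 1].
  have : 0 < Num.min e 1 by rewrite lt_min e0 ltr01.
  have : Num.min e 1 <= e by rewrite ge_min lexx.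
  have : Num.min e 1 <= 1 by rewrite ge_min lexx orbT.
  by rewrite /d; split; lra.
have yn0 u : 0 < u -> y u != 0 by move=> /y_ge1 ?; apply: lt0r_neq0; lra.
pose r u := h u / y u - w / 4 * ln u.
have dr u : 0 < u ->
    is_derive u 1 r ((h1 u * y u - h u * y1 u) / y u ^+ 2 - w / 4 * u^-1).
  move=> u0; have dV := is_deriveV (yn0 u u0) (dy u).
  have := is_derive_subf (is_derive_mulf (dh u u0) dV)
    (is_derive_scalef (w / 4) (is_derive1_ln u0)).
  move=> dd; apply: (is_derive_eq dd); rewrite /GRing.scale/=.
  by field; rewrite yn0// gt_eqF.
have r_le u : 0 < u -> u <= d -> r u <= r d.
  move=> u0 ud.
  have [z|| z zud E] := @MVT_segment R r
    (fun u => (h1 u * y u - h u * y1 u) / y u ^+ 2 - w / 4 * u^-1) u d ud.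
  - by rewrite in_itv/= => /andP[uz _]; apply: dr; exact: lt_trans uz.
  - apply: derivable_within_continuous => z; rewrite in_itv/= => /andP[uz _].
    by apply: ex_derive; apply: dr; exact: lt_le_trans uz.
  move: zud; rewrite in_itv/= => /andP[uz zd].
  have z0 : 0 < z by exact: lt_le_trans uz.
  rewrite -subr_ge0 E mulr_ge0 ?subr_ge0//.
  have -> : h1 z * y z - h z * y1 z = w * expR (- (a * ln z)).
    by rewrite -(wE z z0) expRN mulfK// gt_eqF// expR_gt0.
  have zE : z^-1 <= expR (- (a * ln z)).
    rewrite -{1}(lnK z0) -expRN ler_expR lerN2.
    have : ln z <= 0 by rewrite ln_le0//; lra.
    by move=> lz; have := ler_wnM2r lz a1; rewrite mul1r.
  have yz : (y z ^+ 2)^-1 >= 4^-1.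
    have := y_ge1 z0; have := ye z z0 (le_lt_trans zd de) => y2' y1'.
    rewrite lef_pV2 ?posrE ?exprn_gt0//; [|lra].
    have -> : (4 : R) = 2 ^+ 2 by ring.
    by rewrite lerXn2r// nnegrE; lra.
  have : 4^-1 * z^-1 <= (y z ^+ 2)^-1 * expR (- (a * ln z)).
    by apply: ler_pM => //; rewrite invr_ge0// ltW.
  move=> /(ler_wpM2l (ltW w0)); move: (expR _) (_^-1) (z^-1) => p q s; lra.
(* The threshold is such that [r u <= r d] would force [h u / y u < - M - 1], whereas [y u >= 1]
   gives [h u / y u >= - M]. *)
have lnd : \forall u \near 0^'+, ln u < (- M - `|r d| - 1) / (w / 4).
  by have /cvgrNyPlt := @lnNy R; apply.
have [u [[[u0 ud] hu] lu]] : exists u, ((0 < u /\ u < d) /\ `|h u| <= M) /\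
    ln u < (- M - `|r d| - 1) / (w / 4).
  apply: (@filter_ex _ (0^'+)); near=> u; do !split.
  - by near: u; exact: nbhs_right_gt.
  - by near: u; exact: nbhs_right_lt.
  - by near: u.
  - by near: u.
have := r_le u u0 (ltW ud); rewrite /r -/(r d).
rewrite ltr_pdivlMr in lu; last by lra.
have : - M <= h u / y u.
  have yu := y_ge1 u0; have : `|h u / y u| <= M.
    rewrite normrM normfV (gtr0_norm (lt_le_trans ltr01 yu)).
    rewrite ler_pdivrMr; last by lra.
    by rewrite (le_trans hu)// ler_peMr// (le_trans _ hu).
  by rewrite ler_norml => /andP[].
have := ler_norm (r d); rewrite -/(r d); move: (r d) lu => rd lu.
by move: (h u / y u) => q; lra.
Unshelve. all: by end_near. Qed.

(** The sign bound applies to [h] and to [- h], so the Wronskian vanishes and [h / y] is constant,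
    equal to its value at 1. *)
Lemma bessel_ode_bounded h h1 h2 (M : R) :
  (forall u, 0 < u -> is_derive u 1 h (h1 u)) ->
  (forall u, 0 < u -> is_derive u 1 h1 (h2 u)) ->
  (forall u, 0 < u -> u * h2 u + a * h1 u = c * h u) ->
  (\forall u \near 0^'+, `|h u| <= M) ->
  exists C, forall u, 0 < u -> h u = C * psi a 0 (c * u).
Proof.
move=> dh dh1 ode hM; have [w wE] := wronskian_cst dh dh1 ode.
have w0 : w = 0.
  apply/eqP; rewrite eq_le (wronskian_le0 dh hM wE)/= -oppr_le0.
  apply: (@wronskian_le0 (fun u => - h u) (fun u => - h1 u) M).
  - by move=> u u0; apply: is_deriveN; exact: dh.
  - by under eq_near do rewrite normrN.
  - by move=> u u0; rewrite -(wE u u0); ring.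
have yn0 u : 0 < u -> y u != 0 by move=> /y_ge1 ?; apply: lt0r_neq0; lra.
exists (h 1 / y 1) => u u0.
suff -> : h 1 / y 1 = h u / y u by rewrite divfK// yn0.
pose P (u : R) := 0 < u.
apply: (@is_derive0_convex_cst _ P (fun u => h u / y u)) => //; last exact: ltr01.
  by move=> s t r s0 _ sr _; exact: lt_le_trans sr.
move=> t t0; have dV := is_deriveV (yn0 t t0) (dy t).
apply: (is_derive_eq (is_derive_mulf (dh t t0) dV)); rewrite /GRing.scale/=.
have W0 : h1 t * y t = h t * y1 t.
  apply/eqP; rewrite -subr_eq0; apply/eqP.
  have := wE t t0; rewrite w0 => /eqP; rewrite mulf_eq0 orbC gt_eqF ?expR_gt0//=.
  by move/eqP.
have -> : h1 t = h t * y1 t / y t by rewrite -W0 mulfK// yn0.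
by field; rewrite yn0.
Qed.

End Bessel.
End OrdinaryDifferentialEquations.

(** * Uniqueness: separation of variables for an arbitrary solution *)

Section Uniqueness.
Variables (R : realType) (beta : nat) (b : R) (g : R * R -> R).
Implicit Types (s : R * R) (t u x y : R).
Hypotheses (b0 : b != 0) (beta1 : (1 <= beta)%N) (sol : solution beta b g).

Let gC1 : C1_on (@U R) g. Proof. by have [[]] := sol. Qed.
Let g1C1 : C1_on (@U R) (D1 g). Proof. by have [[]] := sol. Qed.
Let g2C1 : C1_on (@U R) (D2 g). Proof. by have [[]] := sol. Qed.

Let pde1 s : U s -> D1 (D1 g) s - s.2 * D2 (D2 g) s
  = beta%:R / 2 * D2 g s + 2 * b * D1 g s.
Proof. by have [_ h _ _ _] := sol; move=> /h[]. Qed.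

Let pde2 s : U s -> 2 * D2 (D1 g) s + s.1 * D2 (D2 g) s = 2 * b * D2 g s.
Proof. by have [_ h _ _ _] := sol; move=> /h[]. Qed.

Let d1 k x y : C1_on (@U R) k -> U (x, y) ->
  is_derive x 1 (fun t => k (t, y)) (D1 k (x, y)).
Proof.
move=> kC1 xyU; have [d _ _ _] := kC1 _ xyU.
by move/derivableP : d => /is_derive_slice1.
Qed.

Let d2 k x y : C1_on (@U R) k -> U (x, y) ->
  is_derive y 1 (fun t => k (x, t)) (D2 k (x, y)).
Proof.
move=> kC1 xyU; have [_ d _ _] := kC1 _ xyU.
by move/derivableP : d => /is_derive_slice2.
Qed.

(* The second equation says that the y-derivative of
   2 D1 g + x D2 g - 2 b g vanishes. *)
Let char_cst x y y' : U (x, y) -> U (x, y') ->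
  2 * D1 g (x, y) + x * D2 g (x, y) - 2 * b * g (x, y)
  = 2 * D1 g (x, y') + x * D2 g (x, y') - 2 * b * g (x, y').
Proof.
move=> yU y'U; pose P (t : R) := U (x, t).
apply: (@is_derive0_convex_cst _ P
  (fun t => 2 * D1 g (x, t) + x * D2 g (x, t) - 2 * b * g (x, t))) => //.
  by move=> u v t _; rewrite /P /U/= => ? _ ?; lra.
move=> t tU.
have d := is_derive_subf (is_derive_addf (is_derive_scalef 2 (d2 g1C1 tU))
  (is_derive_scalef x (d2 g2C1 tU))) (is_derive_scalef (2 * b) (d2 gC1 tU)).
by apply: (is_derive_eq d); rewrite (pde2 tU) subrr.
Qed.

Let parabola u t : 0 < u -> U (t, (t ^+ 2 - u) / 4).
Proof. by rewrite /U/= => u0; lra. Qed.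

Let P u t := expR (- b * t) * g (t, (t ^+ 2 - u) / 4).

(** The slope [t / 2] of the level curve makes the quantity of [char_cst] appear. Since that depends
    on [t] only, all the [P u] have the same derivative. *)
Let dP u t : 0 < u -> is_derive t 1 (P u)
  (expR (- b * t) / 2 * (2 * D1 g (t, (t ^+ 2 - u) / 4)
    + t * D2 g (t, (t ^+ 2 - u) / 4) - 2 * b * g (t, (t ^+ 2 - u) / 4))).
Proof.
move=> u0.
have dphi : is_derive t 1 (fun t : R => (t ^+ 2 - u) / 4) (t / 2).
  have -> : (fun t : R => (t ^+ 2 - u) / 4) = (fun t => 4^-1 * (t ^+ 2 - u)).
    by apply/funext => r; rewrite mulrC.
  by apply: is_derive_eq; rewrite /GRing.scale/=; field.
have d := is_derive_mulf (is_derive_linexp (- b) t)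
  (is_derive_graph (@open_U R) gC1 (parabola t u0) dphi).
by apply: (is_derive_eq d); field.
Qed.

(** The base values [u = 1] and [t = 0] are a choice: the splitting reads
    [P u t = P 1 t + (P u 0 - P 1 0)]. *)
Let F t := P 1 t.
Let G u := g (0, - u / 4) - g (0, - 1 / 4).

Let g_split s : U s -> g s = expR (b * s.1) * (F s.1 + G (s.1 ^+ 2 - 4 * s.2)).
Proof.
case: s => t y tyU; set u := t ^+ 2 - 4 * y.
have u0 : 0 < u by move: tyU; rewrite /U/= /u; lra.
have key : P u t - P 1 t = P u 0 - P 1 0.
  apply: (@is_derive_0_is_cst _ (fun t => P u t - P 1 t)) => r.
  have d := is_derive_subf (dP r u0) (dP r ltr01).
  apply: (is_derive_eq d).
  by rewrite (char_cst (parabola r u0) (parabola r ltr01)) subrr.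
have EP v : P v 0 = g (0, - v / 4).
  by rewrite /P mulr0 expR0 mul1r expr0n/= sub0r.
have -> : F t + G u = P u t by rewrite /F /G -!EP -key; ring.
rewrite /P mulrA -expRD mulNr subrr expR0 mul1r.
by congr (g (_, _)); rewrite /u/=; field.
Qed.

Let G1 u := - D2 g (0, - u / 4) / 4.
Let G2 u := D2 (D2 g) (0, - u / 4) / 16.
(** These formulas come from solving [g_split] for [F] on the line [s.2 = -1], which lies in [U] for
    every [t] and on which [u = t ^+ 2 + 4]. Only derivatives in the first variable and those of [G]
    are then involved. *)
Let F1 t := expR (- b * t) * (D1 g (t, -1) - b * g (t, -1))
  - 2 * t * G1 (t ^+ 2 + 4).
Let F2 t := expR (- b * t)
    * (D1 (D1 g) (t, -1) - 2 * b * D1 g (t, -1) + b ^+ 2 * g (t, -1))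
  - 2 * G1 (t ^+ 2 + 4) - 4 * t ^+ 2 * G2 (t ^+ 2 + 4).

Let U0 u : 0 < u -> @U R (0, - u / 4).
Proof. by rewrite /U/= expr0n/= => u0; lra. Qed.

Let dlin u : is_derive u 1 (fun u : R => - u / 4) (- 4^-1).
Proof.
have -> : (fun u : R => - u / 4) = (fun u => (- 4^-1) * u).
  by apply/funext => r; ring.
by apply: is_derive_eq; rewrite /GRing.scale/=; ring.
Qed.

Let dG u : 0 < u -> is_derive u 1 G (G1 u).
Proof.
move=> u0; have d := is_derive_subf (is_derive_compf (dlin u) (d2 gC1 (U0 u0)))
  (is_derive_cst (g (0, - 1 / 4)) u 1).
by apply: (is_derive_eq d); rewrite /G1; field.
Qed.

Let dG1 u : 0 < u -> is_derive u 1 G1 (G2 u).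
Proof.
move=> u0; have d := is_derive_scalef (- 4^-1)
  (is_derive_compf (dlin u) (d2 g2C1 (U0 u0))).
have -> : G1 = fun u => - 4^-1 * D2 g (0, - u / 4).
  by apply/funext => r; rewrite /G1; ring.
by apply: (is_derive_eq d); rewrite /G2; field.
Qed.

Let Um1 t : U (t, -1).
Proof. by rewrite /U/=; have := sqr_ge0 t; lra. Qed.

Let sq4 t : 0 < t ^+ 2 + 4. Proof. by have := sqr_ge0 t; lra. Qed.

Let dsq t : is_derive t 1 (fun t : R => t ^+ 2 + 4) (2 * t).
Proof. by apply: is_derive_eq; rewrite /GRing.scale/=; ring. Qed.

Let FE t : F t = expR (- b * t) * g (t, -1) - G (t ^+ 2 + 4).
Proof.
rewrite (g_split (Um1 t))/= mulrA -expRD mulNr addNr expR0 mul1r.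
by rewrite mulrN1 opprK addrK.
Qed.

Let dF t : is_derive t 1 F (F1 t).
Proof.
have -> : F = fun t => expR (- b * t) * g (t, -1) - G (t ^+ 2 + 4).
  by apply/funext.
have d := is_derive_subf
  (is_derive_mulf (is_derive_linexp (- b) t) (d1 gC1 (Um1 t)))
  (is_derive_compf (dsq t) (dG (sq4 t))).
by apply: (is_derive_eq d); rewrite /F1; ring.
Qed.

Let dF1 t : is_derive t 1 F1 (F2 t).
Proof.
have d := is_derive_subf
  (is_derive_mulf (is_derive_linexp (- b) t)
    (is_derive_subf (d1 g1C1 (Um1 t)) (is_derive_scalef b (d1 gC1 (Um1 t)))))
  (is_derive_mulf (is_derive_scalef 2 (is_derive_id t 1))
    (is_derive_compf (dsq t) (dG1 (sq4 t)))).
by apply: (is_derive_eq d); rewrite /F2; ring.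
Qed.

Let w (s : R * R) := s.1 ^+ 2 - 4 * s.2.

Let dw1 x y : is_derive x 1 (fun t : R => t ^+ 2 - 4 * y) (2 * x).
Proof. by apply: is_derive_eq; rewrite /GRing.scale/=; ring. Qed.

Let dw2 x y : is_derive y 1 (fun t : R => x ^+ 2 - 4 * t) (- 4).
Proof. by apply: is_derive_eq; rewrite /GRing.scale/=; ring. Qed.

Let w0 s : U s -> 0 < w s. Proof. by rewrite /U /w/= subr_gt0. Qed.

Let e (s : R * R) := expR (b * s.1).

Let g1E s : U s -> D1 g s = e s * (b * (F s.1 + G (w s)) + F1 s.1 + 2 * s.1 * G1 (w s)).
Proof.
move=> sU; rewrite (D1_U_eq g_split sU).
have d := is_derive_mulf (is_derive_linexp b s.1)
  (is_derive_addf (dF s.1) (is_derive_compf (dw1 s.1 s.2) (dG (w0 sU)))).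
apply: etrans; first exact: (@D1_val _ _ s _ d).
by rewrite /e /w/=; ring.
Qed.

Let g2E s : U s -> D2 g s = - 4 * (e s * G1 (w s)).
Proof.
move=> sU; rewrite (D2_U_eq g_split sU).
have d := is_derive_scalef (expR (b * s.1)) (is_derive_addf
  (is_derive_cst (F s.1) s.2 1) (is_derive_compf (dw2 s.1 s.2) (dG (w0 sU)))).
apply: etrans; first exact: (@D2_val _ _ s _ d).
by rewrite /e /w/=; ring.
Qed.

Let g11E s : U s -> D1 (D1 g) s = e s * (b ^+ 2 * (F s.1 + G (w s))
  + 2 * b * (F1 s.1 + 2 * s.1 * G1 (w s)) + F2 s.1 + 2 * G1 (w s)
  + 4 * s.1 ^+ 2 * G2 (w s)).
Proof.
move=> sU; rewrite (D1_U_eq g1E sU).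
have dGw := is_derive_compf (dw1 s.1 s.2) (dG (w0 sU)).
have dG1w := is_derive_compf (dw1 s.1 s.2) (dG1 (w0 sU)).
have d := is_derive_mulf (is_derive_linexp b s.1)
  (is_derive_addf (is_derive_addf (is_derive_scalef b
    (is_derive_addf (dF s.1) dGw)) (dF1 s.1))
    (is_derive_mulf (is_derive_scalef 2 (is_derive_id s.1 1)) dG1w)).
apply: etrans; first exact: (@D1_val _ _ s _ d).
by rewrite /e /w/=; ring.
Qed.

Let g22E s : U s -> D2 (D2 g) s = 16 * (e s * G2 (w s)).
Proof.
move=> sU; rewrite (D2_U_eq g2E sU).
have d := is_derive_scalef (- 4) (is_derive_scalef (expR (b * s.1))
  (is_derive_compf (dw2 s.1 s.2) (dG1 (w0 sU)))).
apply: etrans; first exact: (@D2_val _ _ s _ d).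
by rewrite /e /w/=; ring.
Qed.

(** The first equation is read at the point with coordinates [t] and [u], which vary independently.
    The terms [t ^+ 2 * G2 u] of [D1 (D1 g)] and [s.2 * D2 (D2 g)] cancel, as do the first-order
    terms [2 * b * (F1 t + 2 * t * G1 u)]. *)
Let separated t u : 0 < u ->
  F2 t - b ^+ 2 * F t + (4 * u * G2 u + (2 + 2 * beta%:R) * G1 u - b ^+ 2 * G u) = 0.
Proof.
move=> u0; have sU := parabola t u0.
have := pde1 sU; rewrite (g11E sU) (g1E sU) (g2E sU) (g22E sU) /=.
have -> : w (t, (t ^+ 2 - u) / 4) = u by rewrite /w/=; field.
have e0 : e (t, (t ^+ 2 - u) / 4) != 0 by rewrite gt_eqF// expR_gt0.
move: (e _) e0 => E E0 /eqP; rewrite -subr_eq0 => /eqP H.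
by apply: (mulfI E0); rewrite mulr0 -[RHS]H; field.
Qed.

Lemma solution_ksol : exists A B C, forall s, U s ->
  g s = ksol ((beta%:R + 1) / 2) b A B C s.
Proof.
have [K [FK GK]] : exists K, (forall t, F2 t = b ^+ 2 * F t + K) /\
    (forall u, 0 < u -> 4 * u * G2 u + (2 + 2 * beta%:R) * G1 u = b ^+ 2 * G u - K).
  exists (F2 0 - b ^+ 2 * F 0); split => [t|u u0].
    move: (separated t ltr01) (separated 0 ltr01).
    move: (F2 t) (F2 0) (F t) (F 0) (G2 1) (G1 1) (G 1) => p q r s x y z.
    by lra.
  move: (separated 0 u0); move: (F2 0) (F 0) (G2 u) (G1 u) (G u) => p q r s x.
  by lra.
(* Raising [F] and lowering [G] by [K / b ^+ 2] leaves [F + G] unchanged and makes both equations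
   homogeneous. *)
have {}FK t : F2 t = b ^+ 2 * (F t + K / b ^+ 2) by rewrite FK; field.
have [A [B AB]] := ode_exp (F := fun t => F t + K / b ^+ 2) b0
  (fun t => is_derive_eq (is_derive_addf (dF t) (is_derive_cst (K / b ^+ 2) t 1))
     (addr0 _)) dF1 FK.
have a1 : 1 <= (beta%:R + 1) / 2 :> R.
  have : 1 <= beta%:R :> R by rewrite ler1n.
  by lra.
have c0 : 0 <= b ^+ 2 / 4 by rewrite divr_ge0// sqr_ge0.
(* The origin is approached along the points [(0, - u / 4)], which lie in [U] for [u > 0]. *)
have [L GL] : exists L : R, G u @[u --> (0 : R)^'+] --> L.
  have [_ _ /cvg_ex[L gL] _ _] := sol; exists (L - g (0, - 1 / 4)).
  have lim : (fun u => ((0 : R), - u / 4)) @ 0^'+ --> ((0 : R), (0 : R)).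
    have : - u / 4 @[u --> (0 : R)^'+] --> (- 0 / 4 : R).
      by apply: cvgM; [apply: cvgN; exact: cvg_within|exact: cvg_cst].
    by rewrite oppr0 mul0r => h; exact: (cvg_pair (cvg_cst (0 : R)) h).
  have cG : g (0, - u / 4) @[u --> (0 : R)^'+] --> L.
    apply: (cvg_comp (fun u => ((0 : R), - u / 4)) g _ gL) => S /= SU.
    have US : \forall u \near 0^'+, U (0, - u / 4) -> S (0, - u / 4) by exact: (lim _ SU).
    apply: filterS2 US (nbhs_right_gt 0) => u US u0.
    by apply: US; exact: U0.
  exact: (cvgB cG (cvg_cst _)).
(* Division of the equation for [G] by 4 gives the parameters [a = (beta + 1) / 2] and
   [c = b ^+ 2 / 4]. *)
have [C GC] : exists C, forall u, 0 < u ->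
    G u - K / b ^+ 2 = C * psi ((beta%:R + 1) / 2) 0 (b ^+ 2 / 4 * u).
  apply: (@bessel_ode_bounded _ _ _ a1 c0 (fun u => G u - K / b ^+ 2) G1 G2
    (`|L - K / b ^+ 2| + 1)).
  - move=> u u0; rewrite -[G1 u]subr0.
    exact: (is_derive_subf (dG u0) (is_derive_cst (K / b ^+ 2) u 1)).
  - exact: dG1.
  - move=> u u0; have -> : b ^+ 2 / 4 * (G u - K / b ^+ 2) = (b ^+ 2 * G u - K) / 4.
      by field.
    by rewrite -GK//; field.
  - have : `|G u - K / b ^+ 2| @[u --> (0 : R)^'+] --> `|L - K / b ^+ 2|.
      by apply: cvg_norm; apply: cvgB => //; exact: cvg_cst.
    move=> /cvgr_le; apply; lra.
exists A, B, C => s sU; rewrite (g_split sU).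
have -> : F s.1 + G (s.1 ^+ 2 - 4 * s.2) =
    (F s.1 + K / b ^+ 2) + (G (w s) - K / b ^+ 2) by rewrite /w; ring.
rewrite AB (GC _ (w0 sU)) /ksol /bess /bessel_arg -/(w s) expRN.
have -> : expR (2 * b * s.1) = expR (b * s.1) * expR (b * s.1).
  by rewrite -expRD; congr expR; ring.
have e0 : expR (b * s.1) != 0 by rewrite gt_eqF// expR_gt0.
by move: (psi _ _ _) => p; field.
Qed.

End Uniqueness.

(** * From [g] to [L] *)

Section LFormula.
Variables (R : realType) (beta : nat) (b C : R) (g : R * R -> R).
Hypotheses (beta1 : (1 <= beta)%N) (gE : forall s, U s -> g s = gsol beta b C s).

Let a1 : 1 <= (beta%:R + 1) / 2 :> R.
Proof. by have : 1 <= beta%:R :> R; [rewrite ler1n|lra]. Qed.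

Lemma extU_gsol s : 4 * s.2 <= s.1 ^+ 2 -> extU g s = gsol beta b C s.
Proof.
move=> sU; rewrite (gsol_ksol b a1 C (erefl _) sU); apply: (extU_ksol a1) => // r rU.
by rewrite gE// (gsol_ksol b a1 C (erefl _))// ltW.
Qed.

(** The discriminant bound places trace and determinant in the closure of [U], where [extU g] is
    [gsol]; positivity of [L] then makes [ln] and [expR] inverse to each other. Abstracting over [T]
    serves all three kinds of matrices. *)
Lemma L_of_formula (T : Type) (herm : T -> Prop) (tr det : T -> R) (L : T -> R) :
  (forall A, herm A -> 4 * det A <= tr A ^+ 2) ->
  L_of herm tr det b g L <-> L_formula herm tr det beta b C L.
Proof.
move=> disc; split=> h A hA.
  have [L0] := h A hA; rewrite extU_gsol/= ?disc// => ->.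
  by rewrite -{1}(lnK L0); congr expR; rewrite [_^-1 * _]mulrC; ring.
rewrite (h A hA) expR_gt0 expRK extU_gsol/= ?disc//; split=> //.
by rewrite [_^-1 * _]mulrC; ring.
Qed.

End LFormula.

(** * Discriminants of self-adjoint matrices *)

Section Discriminants.
Variable R : realType.

Let lift01 : lift ord0 ord0 = ord_max :> 'I_2. Proof. exact/val_inj. Qed.

Lemma det_mx2 (K : comNzRingType) (A : 'M[K]_2) :
  \det A = A ord0 ord0 * A ord_max ord_max - A ord0 ord_max * A ord_max ord0.
Proof.
have lift10 : lift ord_max ord0 = ord0 :> 'I_2 by exact/val_inj.
rewrite (expand_det_row _ ord0) big_ord_recl big_ord1 /cofactor !det_mx11 !mxE.
by rewrite lift01 lift10 expr0 expr1 mul1r mulN1r mulrN.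
Qed.

Lemma mxtrace2 (K : comNzRingType) (A : 'M[K]_2) :
  \tr A = A ord0 ord0 + A ord_max ord_max.
Proof. by rewrite /mxtrace big_ord_recl big_ord1 lift01. Qed.

(** The discriminant is [(a - d)^2 + 4 |c|^2], with [c] the off-diagonal entry; the complex and
    quaternionic cases rest on the same sum of squares. *)
Lemma discr_real (A : 'M[R]_2) : self_adjoint id A -> 4 * \det A <= (\tr A) ^+ 2.
Proof.
move=> /matrixP/(_ ord0 ord_max); rewrite !mxE det_mx2 mxtrace2 => ->.
move: (A ord0 ord0) (A ord_max ord_max) (A ord0 ord_max) => a d c.
by have := sqr_ge0 (a - d); have := sqr_ge0 c; nra.
Qed.

Lemma discr_complex (A : 'M[R[i]]_2) : self_adjoint (@conjc R) A ->
  4 * cdet A <= ctr A ^+ 2.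
Proof.
move=> /matrixP sA.
have := sA ord0 ord_max; have := sA ord0 ord0; have := sA ord_max ord_max.
rewrite /cdet /ctr det_mx2 mxtrace2 !mxE.
case: (A ord0 ord0) => a a'; case: (A ord_max ord_max) => d d'.
case: (A ord0 ord_max) => p q; case: (A ord_max ord0) => p' q'.
move=> [d0] [a0] [pE qE] /=.
have := sqr_ge0 (a - d); have := sqr_ge0 p; have := sqr_ge0 q.
have -> : d' = 0 by lra.
by rewrite -pE -qE; nra.
Qed.

Lemma discr_quat (A : 'M[quat R]_2) : self_adjoint (@conjq R) A ->
  4 * qdet A <= qtr A ^+ 2.
Proof.
move=> /self_adjoint_quat[a [d [q [A00 A11 A01 A10]]]].
rewrite /qdet /qtr /mxtrace big_ord_recl big_ord1 lift01 A00 A11 A01 A10.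
case: q {A01 A10} => x y z t /=; rewrite -subr_ge0.
have -> : (a + d) ^+ 2 - 4 * (a * d - 0 * 0 - 0 * 0 - 0 * 0 - (x * x - y * - y - z * - z - t * - t))
   = (a - d) ^+ 2 + 4 * (x ^+ 2 + y ^+ 2 + z ^+ 2 + t ^+ 2) by ring.
by rewrite addr_ge0 ?sqr_ge0// mulr_ge0// !addr_ge0// sqr_ge0.
Qed.

End Discriminants.

Theorem proposition5p5 (R : realType) (beta : nat) (b : R)
    (hbeta : beta \in [:: 1; 2; 4]%N) (hb : b != 0) (g : R * R -> R) :
  (solution beta b g <->
     exists C : R, forall s, @U R s -> g s = gsol beta b C s)
  /\
  (forall C : R, (forall s, @U R s -> g s = gsol beta b C s) ->
    [/\ beta = 1%N -> forall L : 'M[R]_2 -> R,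
          L_of (@self_adjoint R id) (fun A => \tr A) (fun A => \det A) b g L <->
          L_formula (@self_adjoint R id) (fun A => \tr A) (fun A => \det A)
            beta b C L,
        beta = 2%N -> forall L : 'M[R[i]]_2 -> R,
          L_of (@self_adjoint R[i] (@conjc R)) (@ctr R) (@cdet R) b g L <->
          L_formula (@self_adjoint R[i] (@conjc R)) (@ctr R) (@cdet R)
            beta b C L
      & beta = 4%N -> forall L : 'M[quat R]_2 -> R,
          L_of (@self_adjoint (quat R) (@conjq R)) (@qtr R) (@qdet R) b g L <->
          L_formula (@self_adjoint (quat R) (@conjq R)) (@qtr R) (@qdet R)
            beta b C L]).
Proof.
have beta1 : (1 <= beta)%N by move: hbeta; rewrite !inE => /or3P[]/eqP->.
have a1 : 1 <= (beta%:R + 1) / 2 :> R.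
  by have : 1 <= beta%:R :> R; [rewrite ler1n|lra].
split; last first.
  move=> C gE; split=> ? L; apply: L_of_formula => //.
  - exact: discr_real.
  - exact: discr_complex.
  - exact: discr_quat.
split=> [sol|[C gE]].
  have [A [B [D gE]]] := solution_ksol hb beta1 sol.
  have [_ _ _ g00 dg] := sol.
  have ABD : A + B + D = 0.
    have : extU g (0, 0) = ksol ((beta%:R + 1) / 2) b A B D (0, 0).
      by apply: (extU_ksol a1 gE); rewrite /= mulr0 sqr_ge0.
    by rewrite ksol00 g00.
  have dAD : 2 * b * A + b * D = (2 * b)^-1.
    have dk := is_derive_extU_ksol a1 gE.
    by rewrite -(@derive_val _ _ _ _ _ _ _ dg) (@derive_val _ _ _ _ _ _ _ dk).
  (* Solves [(1 - C) / (2 * b ^+ 2) = A], the coefficient of [expR (2 * b * s.1)] in [gsol_ksol];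
     the two initial conditions then determine [D] and [B]. *)
  exists (1 - 2 * b ^+ 2 * A) => s sU.
  rewrite (gsol_ksol b a1 _ (erefl _) (ltW sU)) gE//.
  have DE : D = (2 * b ^+ 2)^-1 - 2 * A.
    by apply: (mulfI hb); rewrite -[LHS](addKr (2 * b * A)) dAD; field.
  have BE : B = A - (2 * b ^+ 2)^-1.
    by rewrite -[LHS]subr0 -ABD DE; ring.
  by rewrite BE DE; congr ksol; field.
(* These coefficients satisfy both linear conditions of [ksol_solution] identically in [C]. *)
have sol : solution beta b (ksol ((beta%:R + 1) / 2) b ((1 - C) / (2 * b ^+ 2))
    (- C / (2 * b ^+ 2)) ((2 * C - 1) / (2 * b ^+ 2))).
  by apply: (ksol_solution a1) => //; field.
apply: solution_U_eq sol => s sU.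
by rewrite gE// (gsol_ksol b a1 _ (erefl _))// ltW.
Qed.
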